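(* Let $A$ be a unital algebra with differential graded algebra $(\Omega,\mathrm d)$ and let $(\nabla,\sigma)$ be a bimodule connection on $\Omega^1$ which is torsion free, $\wedge$-compatible and extendable and whose $\sigma$ obeys the braid relations. Then the braided binomials restrict to define a unital associative product $$\odot=\left[{i+j\atop j},\sigma\right]:\Omega^i_S\otimes_A\Omega^j_S\to\Omega^{i+j}_S$$ making $\Omega_S:=\bigoplus_{k=0}^\infty\Omega^k_S$ into a graded algebra.
   Context: Everything is over a field. $A$ is a unital algebra and $(\Omega=\oplus_n\Omega^n,\mathrm d)$ is a differential graded algebra with $\Omega^0=A$, product $\wedge$, $\mathrm d^2=0$, graded Leibniz rule and $\Omega$ generated by $A,\mathrm dA$. $\Omega^{1\otimes_An}$ is the $n$-fold tensor power over $A$; $\wedge_i,\sigma_i$ denote $\wedge,\sigma$ applied in tensor factors $i,i+1$. A bimodule connection $(\nabla,\sigma)$ on $\Omega^1$ is a linear map $\nabla:\Omega^1\to\Omega^1\otimes_A\Omega^1$ and a bimodule map $\sigma:\Omega^1\otimes_A\Omega^1\to\Omega^1\otimes_A\Omega^1$ with $\nabla(a\omega)=\mathrm da\otimes\omega+a\nabla\omega$, $\nabla(\omega a)=(\nabla\omega)a+\sigma(\omega\otimes\mathrm da)$. Torsion free: $\wedge\circ\nabla=\mathrm d$. $\wedge$-compatible: $\nabla_{\Omega^2}(\eta\wedge\omega):=(\nabla\eta)\wedge\omega+\wedge_2\sigma_1(\eta\otimes\nabla\omega)$ is a well-defined bimodule connection on $\Omega^2$ (which entails that $\omega\wedge\eta\otimes\zeta\mapsto\wedge_2\sigma_1\sigma_2(\omega\otimes\eta\otimes\zeta)$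 is a well-defined bimodule map $\Omega^2\otimes_A\Omega^1\to\Omega^1\otimes_A\Omega^2$). Extendable: $\omega\otimes\eta\wedge\zeta\mapsto\wedge_1\sigma_2\sigma_1(\omega\otimes\eta\otimes\zeta)$ is a well-defined bimodule map $\Omega^1\otimes_A\Omega^2\to\Omega^2\otimes_A\Omega^1$. Braid relations: $\sigma_1\sigma_2\sigma_1=\sigma_2\sigma_1\sigma_2$ on $\Omega^{1\otimes_A3}$. Quantum symmetric forms: $\Omega^0_S=A$, $\Omega^1_S=\Omega^1$, $\Omega^k_S=\bigcap_{i<k}\ker\wedge_i\subseteq\Omega^{1\otimes_Ak}$. Braided binomials on $\Omega^{1\otimes_An}$: $\left[{n\atop0},\sigma\right]=\left[{n\atop n},\sigma\right]=\mathrm{id}^n$ and, for $0<k<n$, $\left[{n\atop k},\sigma\right]=\left(\mathrm{id}\otimes\left[{n-1\atop k-1},\sigma\right]\right)\sigma_1\cdots\sigma_{n-k}+\mathrm{id}\otimes\left[{n-1\atop k},\sigma\right]$. *)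

(* Defs.v *)
From HB Require Import structures.
From mathcomp Require Import all_boot all_order all_algebra.
From mathcomp Require Import generic_quotient boolp.

Set Implicit Arguments.
Unset Strict Implicit.
Unset Printing Implicit Defensive.

Import GRing.Theory.
Local Open Scope ring_scope.
Local Open Scope quotient_scope.

Record bimod_axioms (k : fieldType) (A : algType k) (M : lmodType k)
    (l : A -> M -> M) (r : M -> A -> M) : Prop := BimodAxioms {
  lactDl : forall a b x, l (a + b) x = l a x + l b x;
  lactDr : forall a x y, l a (x + y) = l a x + l a y;
  lactM  : forall a b x, l (a * b) x = l a (l b x);
  lact1  : forall x, l 1 x = x;
  ractDl : forall x y a, r (x + y) a = r x a + r y a;
  ractDr : forall x a b, r x (a + b) = r x a + r x b;
  ractM  : forall x a b, r x (a * b) = r (r x a) b;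
  ract1  : forall x, r x 1 = x;
  lractA : forall a x b, l a (r x b) = r (l a x) b;
  lactZ  : forall (c : k) x, l c%:A x = c *: x;
  ractZ  : forall x (c : k), r x c%:A = c *: x }.

Record bimod (k : fieldType) (A : algType k) := Bimod {
  bimod_sort :> lmodType k;
  lact : A -> bimod_sort -> bimod_sort;
  ract : bimod_sort -> A -> bimod_sort;
  bimodP : bimod_axioms lact ract }.

Record bimod_map (k : fieldType) (A : algType k) (M N : bimod A)
    (f : M -> N) : Prop := BimodMap {
  bmap_linear : linear f;
  bmap_lact : forall a x, f (lact a x) = lact a (f x);
  bmap_ract : forall x a, f (ract x a) = ract (f x) a }.

Section Regular.
Variables (k : fieldType) (A : algType k).

Lemma regular_axioms : @bimod_axioms k A A *%R *%R.
Proof.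
split => //.
- by move=> a b x; rewrite mulrDl.
- by move=> a x y; rewrite mulrDr.
- by move=> a b x; rewrite mulrA.
- by move=> x; rewrite mul1r.
- by move=> x y a; rewrite mulrDl.
- by move=> x a b; rewrite mulrDr.
- by move=> x a b; rewrite mulrA.
- by move=> x; rewrite mulr1.
- by move=> a x b; rewrite mulrA.
- by move=> c x; rewrite -scalerAl mul1r.
- by move=> x c; rewrite -scalerAr mulr1.
Qed.

Definition regular : bimod A := Bimod regular_axioms.

End Regular.

Section BimodTheory.
Variables (k : fieldType) (A : algType k).
Implicit Types M N P : bimod A.

Lemma ract0 M (x : M) : ract x 0 = 0.
Proof.
by apply: (@addrI _ (ract x 0)); rewrite -(ractDr (bimodP M)) !addr0.
Qed.

Lemma lact0r M (a : A) : lact a (0 : M) = 0.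
Proof.
by apply: (@addrI _ (lact a (0 : M))); rewrite -(lactDr (bimodP M)) !addr0.
Qed.

Lemma ract0l M (a : A) : ract (0 : M) a = 0.
Proof.
by apply: (@addrI _ (ract (0 : M) a)); rewrite -(ractDl (bimodP M)) !addr0.
Qed.

Lemma bmapD M N (f : M -> N) : bimod_map f -> {morph f : x y / x + y}.
Proof. by case=> lf _ _ x y; rewrite -[x]scale1r lf !scale1r. Qed.

Lemma bmapZ M N (f : M -> N) : bimod_map f -> forall c x, f (c *: x) = c *: f x.
Proof. by case=> lf bl _ c x; rewrite -(lactZ (bimodP _)) bl (lactZ (bimodP _)). Qed.

Lemma bmap0 M N (f : M -> N) : bimod_map f -> f 0 = 0.
Proof. by move=> fb; apply: (@addrI _ (f 0)); rewrite -bmapD // !addr0. Qed.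

(* [k]-linearity is automatic for bi-equivariant additive maps *)
Lemma bimod_mapI M N (f : M -> N) :
    {morph f : x y / x + y} -> (forall a x, f (lact a x) = lact a (f x)) ->
    (forall x a, f (ract x a) = ract (f x) a) -> bimod_map f.
Proof.
move=> fD fl fr; split=> // c x y.
by rewrite fD -(lactZ (bimodP _)) fl (lactZ (bimodP _)).
Qed.

Lemma bimod_map_id M : bimod_map (@id M).
Proof. by apply: BimodMap. Qed.

Lemma bimod_map_comp M N P (g : N -> P) (f : M -> N) :
  bimod_map g -> bimod_map f -> bimod_map (g \o f).
Proof.
move=> gb fb; apply: bimod_mapI => [x y|a x|x a] /=.
- by rewrite !bmapD.
- by rewrite (bmap_lact fb) (bmap_lact gb).
- by rewrite (bmap_ract fb) (bmap_ract gb).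
Qed.

Lemma bimod_map0 M N : bimod_map (fun _ : M => 0 : N).
Proof.
by apply: bimod_mapI => [x y|a x|x a]; rewrite ?addr0 ?lact0r ?ract0l.
Qed.

End BimodTheory.

Section Tensor.
Variables (k : fieldType) (A : algType k) (M N : bimod A).

(* A list [:: (m1, n1); ...] stands for the sum of the [mi (x) ni]; the        *)
(* relation below is the congruence on these formal sums generated by         *)
(* biadditivity and [A]-balancedness. Since [(m, n) + (- m, n) ~ (0, n) ~ 0], *)
(* the quotient monoid is a group, namely the tensor product over [A].        *)
Inductive tens_eq : seq (M * N) -> seq (M * N) -> Prop :=
| tens_refl s : tens_eq s s
| tens_sym s t : tens_eq s t -> tens_eq t s
| tens_trans t s u : tens_eq s t -> tens_eq t u -> tens_eq s u
| tens_cat s s' t t' :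
    tens_eq s s' -> tens_eq t t' -> tens_eq (s ++ t) (s' ++ t')
| tens_comm s t : tens_eq (s ++ t) (t ++ s)
| tens_0l n : tens_eq [:: (0, n)] [::]
| tens_Dl m m' n : tens_eq [:: (m + m', n)] [:: (m, n); (m', n)]
| tens_Dr m n n' : tens_eq [:: (m, n + n')] [:: (m, n); (m, n')]
| tens_bal m a n : tens_eq [:: (ract m a, n)] [:: (m, lact a n)].

Definition tens_eqb s t := `[< tens_eq s t >].

Lemma tens_eqb_refl : reflexive tens_eqb.
Proof. by move=> s; apply/asboolP; apply: tens_refl. Qed.

Lemma tens_eqb_sym : symmetric tens_eqb.
Proof. by move=> s t; apply/asboolP/asboolP; apply: tens_sym. Qed.

Lemma tens_eqb_trans : transitive tens_eqb.
Proof.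
move=> t s u /asboolP st /asboolP tu; apply/asboolP; exact: tens_trans st tu.
Qed.

Definition tens_equiv := EquivRel tens_eqb tens_eqb_refl tens_eqb_sym tens_eqb_trans.

Definition tensor := {eq_quot tens_equiv}.

HB.instance Definition _ := Choice.on tensor.
HB.instance Definition _ := Quotient.on tensor.

Lemma tens_eqP (s t : seq (M * N)) :
  (\pi_tensor s = \pi_tensor t) <-> tens_eq s t.
Proof.
split=> [/eqmodP/asboolP //|st]; apply/eqmodP; exact/asboolP.
Qed.

Lemma tens_repr (s : seq (M * N)) : tens_eq (repr (\pi_tensor s)) s.
Proof. by apply/tens_eqP; rewrite reprK. Qed.

Definition tens_zero : tensor := \pi_tensor [::].
Definition tens_add (x y : tensor) : tensor := \pi_tensor (repr x ++ repr y).
Definition tens_opp (x : tensor) : tensor :=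
  \pi_tensor [seq (- p.1, p.2) | p <- repr x].

Lemma tens_addE s t : tens_add (\pi_tensor s) (\pi_tensor t) = \pi_tensor (s ++ t).
Proof. by apply/tens_eqP; apply: tens_cat; apply: tens_repr. Qed.

Lemma tens_addA : associative tens_add.
Proof.
elim/quotW=> s; elim/quotW=> t; elim/quotW=> u.
rewrite (tens_addE t u) (tens_addE s t) (tens_addE s (t ++ u)).
by rewrite (tens_addE (s ++ t) u) catA.
Qed.

Lemma tens_addC : commutative tens_add.
Proof.
elim/quotW=> s; elim/quotW=> t; rewrite (tens_addE s t) (tens_addE t s).
by apply/tens_eqP; apply: tens_comm.
Qed.

Lemma tens_add0 : left_id tens_zero tens_add.
Proof. by elim/quotW=> s; rewrite (tens_addE [::] s). Qed.

Lemma tens_addN : left_inverse tens_zero tens_opp tens_add.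
Proof.
move=> x; rewrite -{2}[x]reprK.
rewrite (tens_addE [seq (- p.1, p.2) | p <- repr x] (repr x)); apply/tens_eqP.
elim: (repr x) => [|[m n] s IH] /=; first exact: tens_refl.
rewrite -cat1s -[(m, n) :: s]cat1s catA.
apply: (@tens_trans ([:: (- m, n)] ++ [:: (m, n)] ++
          ([seq (- p.1, p.2) | p <- s] ++ s))).
  rewrite -!catA; apply: tens_cat; first exact: tens_refl.
  rewrite !catA; apply: tens_cat; [exact: tens_comm | exact: tens_refl].
rewrite catA -[X in tens_eq _ X](cats0 [::]); apply: tens_cat => //.
apply: (@tens_trans [:: (0, n)]); last exact: tens_0l.
by apply: tens_sym; rewrite -(addNr m); apply: tens_Dl.
Qed.

HB.instance Definition _ :=
  GRing.isZmodule.Build tensor tens_addA tens_addC tens_add0 tens_addN.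

Definition tpure (m : M) (n : N) : tensor := \pi_tensor [:: (m, n)].

Lemma tpureDl m m' n : tpure (m + m') n = tpure m n + tpure m' n.
Proof.
rewrite [RHS](tens_addE [:: (m, n)] [:: (m', n)]).
by apply/tens_eqP; apply: tens_Dl.
Qed.

Lemma tpureDr m n n' : tpure m (n + n') = tpure m n + tpure m n'.
Proof.
rewrite [RHS](tens_addE [:: (m, n)] [:: (m, n')]).
by apply/tens_eqP; apply: tens_Dr.
Qed.

Lemma tpure_bal m a n : tpure (ract m a) n = tpure m (lact a n).
Proof. by apply/tens_eqP; apply: tens_bal. Qed.

Lemma tensor_ind (P : tensor -> Prop) :
    P 0 -> (forall x y, P x -> P y -> P (x + y)) -> (forall m n, P (tpure m n)) ->
  forall x, P x.
Proof.
move=> P0 PD Pt x; rewrite -[x]reprK.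
elim: (repr x) => [|[m n] s IH] //.
have -> : \pi_tensor ((m, n) :: s) = tpure m n + \pi_tensor s.
  by rewrite [RHS](tens_addE [:: (m, n)] s).
exact: PD.
Qed.

Record balanced (V : zmodType) (f : M -> N -> V) : Prop := Balanced {
  balDl : forall m m' n, f (m + m') n = f m n + f m' n;
  balDr : forall m n n', f m (n + n') = f m n + f m n';
  balA  : forall m a n, f (ract m a) n = f m (lact a n) }.

(* The map [m (x) n |-> f m n]; it is the map given by the universal property *)
(* whenever [f] is balanced, and is meaningless otherwise.                    *)
Definition tlift (V : zmodType) (f : M -> N -> V) (x : tensor) : V :=
  \sum_(p <- repr x) f p.1 p.2.

Lemma tlift_pi (V : zmodType) (f : M -> N -> V) s : balanced f ->
  tlift f (\pi_tensor s) = \sum_(p <- s) f p.1 p.2.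
Proof.
case=> fDl fDr fA; rewrite /tlift.
suff tens_eq_sum t u : tens_eq t u ->
    \sum_(p <- t) f p.1 p.2 = \sum_(p <- u) f p.1 p.2.
  exact/tens_eq_sum/tens_repr.
elim=> {t u} //=.
- by move=> t s' u _ -> _ ->.
- by move=> s1 s2 t1 t2 _ e1 _ e2; rewrite !big_cat /= e1 e2.
- by move=> s1 t1; rewrite !big_cat /= addrC.
- move=> n; rewrite big_seq1 big_nil /=.
  by apply: (@addrI _ (f 0 n)); rewrite -fDl !addr0.
- by move=> m m' n; rewrite !big_cons !big_nil !addr0 /= fDl.
- by move=> m n n'; rewrite !big_cons !big_nil !addr0 /= fDr.
- by move=> m a n; rewrite !big_seq1 /= fA.
Qed.

Lemma tlift_pure (V : zmodType) (f : M -> N -> V) m n : balanced f ->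
  tlift f (tpure m n) = f m n.
Proof. by move=> fb; rewrite /tpure tlift_pi // big_seq1. Qed.

Lemma tliftD (V : zmodType) (f : M -> N -> V) : balanced f ->
  {morph tlift f : x y / x + y}.
Proof.
move=> fb x y; elim/quotW: x => s; elim/quotW: y => t.
have -> : \pi_tensor s + \pi_tensor t = \pi_tensor (s ++ t) := tens_addE s t.
by rewrite !tlift_pi // big_cat.
Qed.

Lemma tlift0 (V : zmodType) (f : M -> N -> V) : balanced f -> tlift f 0 = 0.
Proof. by move=> fb; apply: (@addrI _ (tlift f 0)); rewrite -tliftD // !addr0. Qed.

Definition tens_scale (c : k) : tensor -> tensor :=
  tlift (fun m n => tpure (c *: m) n).
Definition tens_lact (a : A) : tensor -> tensor :=
  tlift (fun m n => tpure (lact a m) n).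
Definition tens_ract (x : tensor) (a : A) : tensor :=
  tlift (fun m n => tpure m (ract n a)) x.

Lemma tens_lact_bal a : balanced (fun m n => tpure (lact a m) n).
Proof.
split=> [m m' n|m n n'|m b n].
- by rewrite (lactDr (bimodP M)) tpureDl.
- by rewrite tpureDr.
- by rewrite (lractA (bimodP M)) tpure_bal.
Qed.

Lemma tens_ract_bal a : balanced (fun m n => tpure m (ract n a)).
Proof.
split=> [m m' n|m n n'|m b n].
- by rewrite tpureDl.
- by rewrite (ractDl (bimodP N)) tpureDr.
- by rewrite tpure_bal (lractA (bimodP N)).
Qed.

Lemma tens_scaleE c x : tens_scale c x = tens_lact c%:A x.
Proof.
rewrite /tens_scale /tens_lact; congr tlift.
by apply: funext => m; apply: funext => n; rewrite (lactZ (bimodP M)).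
Qed.

Lemma tens_lact_pure a m n : tens_lact a (tpure m n) = tpure (lact a m) n.
Proof. by rewrite /tens_lact tlift_pure //; apply: tens_lact_bal. Qed.

Lemma tens_ract_pure a m n : tens_ract (tpure m n) a = tpure m (ract n a).
Proof. by rewrite /tens_ract tlift_pure //; apply: tens_ract_bal. Qed.

Lemma tens_lactDr a : {morph tens_lact a : x y / x + y}.
Proof. exact/tliftD/tens_lact_bal. Qed.

Lemma tens_ractDl a : {morph tens_ract^~ a : x y / x + y}.
Proof. exact/tliftD/tens_ract_bal. Qed.

Lemma tens_lact0 a : tens_lact a 0 = 0.
Proof. exact/tlift0/tens_lact_bal. Qed.

Lemma tens_ract0 a : tens_ract 0 a = 0.
Proof. exact/tlift0/tens_ract_bal. Qed.

Lemma tens_lactDl a b x : tens_lact (a + b) x = tens_lact a x + tens_lact b x.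
Proof.
elim/tensor_ind: x => [|x y ex ey|m n]; first by rewrite !tens_lact0 addr0.
  by rewrite !tens_lactDr ex ey addrACA.
by rewrite !tens_lact_pure (lactDl (bimodP M)) tpureDl.
Qed.

Lemma tens_lactM a b x : tens_lact (a * b) x = tens_lact a (tens_lact b x).
Proof.
elim/tensor_ind: x => [|x y ex ey|m n]; first by rewrite !tens_lact0.
  by rewrite !tens_lactDr ex ey.
by rewrite !tens_lact_pure (lactM (bimodP M)).
Qed.

Lemma tens_lact1 x : tens_lact 1 x = x.
Proof.
elim/tensor_ind: x => [|x y ex ey|m n]; first by rewrite !tens_lact0.
  by rewrite !tens_lactDr ex ey.
by rewrite !tens_lact_pure (lact1 (bimodP M)).
Qed.

Fact tens_scaleA c d x : tens_scale c (tens_scale d x) = tens_scale (c * d) x.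
Proof. by rewrite !tens_scaleE -tens_lactM -scalerAl mul1r scalerA. Qed.

Fact tens_scale1 : left_id 1 tens_scale.
Proof. by move=> x; rewrite tens_scaleE scale1r tens_lact1. Qed.

Fact tens_scaleDr : right_distributive tens_scale +%R.
Proof. by move=> c x y; rewrite !tens_scaleE tens_lactDr. Qed.

Fact tens_scaleDl x : {morph tens_scale^~ x : c d / c + d}.
Proof. by move=> c d; rewrite !tens_scaleE scalerDl tens_lactDl. Qed.

HB.instance Definition _ := GRing.Zmodule_isLmodule.Build k tensor
  tens_scaleA tens_scale1 tens_scaleDr tens_scaleDl.

Definition tensor_lmod : lmodType k :=
  Eval cbv beta delta [GRing.Lmodule.phant_clone id_phant] in
  GRing.Lmodule.clone k tensor _.

Lemma tens_axioms : @bimod_axioms k A tensor_lmod tens_lact tens_ract.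
Proof.
split.
- exact: tens_lactDl.
- exact: tens_lactDr.
- exact: tens_lactM.
- exact: tens_lact1.
- by move=> x y a; rewrite tens_ractDl.
- move=> x a b; elim/tensor_ind: x => [|x y ex ey|m n].
  + by rewrite !tens_ract0 addr0.
  + by rewrite !tens_ractDl ex ey addrACA.
  + by rewrite !tens_ract_pure (ractDr (bimodP N)) tpureDr.
- move=> x a b; elim/tensor_ind: x => [|x y ex ey|m n].
  + by rewrite !tens_ract0.
  + by rewrite !tens_ractDl ex ey.
  + by rewrite !tens_ract_pure (ractM (bimodP N)).
- move=> x; elim/tensor_ind: x => [|x y ex ey|m n].
  + by rewrite !tens_ract0.
  + by rewrite !tens_ractDl ex ey.
  + by rewrite !tens_ract_pure (ract1 (bimodP N)).
- move=> a x b; elim/tensor_ind: x => [|x y ex ey|m n].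
  + by rewrite !(tens_ract0, tens_lact0).
  + by rewrite !(tens_ractDl, tens_lactDr) ex ey.
  + by rewrite !(tens_ract_pure, tens_lact_pure).
- by move=> c x; rewrite -tens_scaleE.
- move=> x c; rewrite [RHS]tens_scaleE; elim/tensor_ind: x => [|x y ex ey|m n].
  + by rewrite tens_ract0 tens_lact0.
  + by rewrite tens_ractDl tens_lactDr ex ey.
  + rewrite tens_ract_pure tens_lact_pure (ractZ (bimodP N)) (lactZ (bimodP M)).
    by rewrite -(lactZ (bimodP N)) -tpure_bal (ractZ (bimodP M)).
Qed.

Definition tens : bimod A := Bimod tens_axioms.

End Tensor.

Notation "x \ox y" := (tpure x y : bimod_sort (tens _ _))
  (at level 40, left associativity) : ring_scope.

Section TensorMaps.
Variables (k : fieldType) (A : algType k).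
Implicit Types M N P : bimod A.

Definition tmap M M' N N' (f : M -> M') (g : N -> N') : tens M N -> tens M' N' :=
  tlift (fun m n => f m \ox g n).

Definition tassoc M N P : tens (tens M N) P -> tens M (tens N P) :=
  tlift (fun (x : tens M N) (p : P) =>
    tlift (fun (m : M) (n : N) => m \ox (n \ox p)) x).

Definition tassocV M N P : tens M (tens N P) -> tens (tens M N) P :=
  tlift (fun (m : M) (y : tens N P) =>
    tlift (fun (n : N) (p : P) => (m \ox n) \ox p) y).

Lemma tlift_bimod_map M N P (f : M -> N -> P) : balanced f ->
    (forall a m n, f (lact a m) n = lact a (f m n)) ->
    (forall m n a, f m (ract n a) = ract (f m n) a) ->
  bimod_map (tlift f : tens M N -> P).
Proof.
move=> bal fl fr; have f0 := tlift0 bal; have fD := tliftD bal.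
apply: bimod_mapI => [x y|a x|x a]; first exact: fD.
- elim/tensor_ind: x => [|x y ex ey|m n].
  + by rewrite [lact a _](tens_lact0 _ _ a) f0 lact0r.
  + by rewrite [lact a _](tens_lactDr a) !fD (lactDr (bimodP P)) -ex -ey.
  + by rewrite [lact a _](tens_lact_pure a) !(tlift_pure _ _ bal) fl.
- elim/tensor_ind: x => [|x y ex ey|m n].
  + by rewrite [ract _ a](tens_ract0 _ _ a) f0 ract0l.
  + by rewrite [ract _ a](tens_ractDl a) !fD (ractDl (bimodP P)) -ex -ey.
  + by rewrite [ract _ a](tens_ract_pure a) !(tlift_pure _ _ bal) fr.
Qed.

Lemma tmap_bal M N M' N' (f : M -> M') (g : N -> N') :
  bimod_map f -> bimod_map g -> balanced (fun m n => f m \ox g n).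
Proof.
move=> fb gb; split=> [m m' n|m n n'|m a n].
- by rewrite bmapD // tpureDl.
- by rewrite (bmapD gb) tpureDr.
- by rewrite (bmap_ract fb) (bmap_lact gb) tpure_bal.
Qed.

Lemma tmap_bimod_map M N M' N' (f : M -> M') (g : N -> N') :
  bimod_map f -> bimod_map g -> bimod_map (tmap f g).
Proof.
move=> fb gb; apply: tlift_bimod_map => [|a m n|m n a]; first exact: tmap_bal.
- by rewrite (bmap_lact fb) [RHS](tens_lact_pure a).
- by rewrite (bmap_ract gb) [RHS](tens_ract_pure a).
Qed.

Lemma tassocV_bal1 M N P (m : M) :
  balanced (fun (n : N) (p : P) => (m \ox n) \ox p).
Proof.
split=> [n n' p|n p p'|n a p].
- by rewrite tpureDr tpureDl.
- by rewrite tpureDr.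
- by rewrite -tpure_bal [in RHS]/ract /= tens_ract_pure.
Qed.

Lemma tassocV_bal M N P : balanced (fun (m : M) (y : tens N P) =>
  tlift (fun (n : N) (p : P) => (m \ox n) \ox p) y).
Proof.
have bal (m : M) : balanced (fun (n : N) (p : P) => (m \ox n) \ox p) :=
  tassocV_bal1 N P m.
have b0 (m : M) := tlift0 (bal m); have bD (m : M) := tliftD (bal m).
have bP m n p := tlift_pure n p (bal m).
split=> [m m' y|m y y'|m a y]; last 1 first.
- elim/tensor_ind: y => [|x y ex ey|n p].
  + by rewrite [lact a _](tens_lact0 _ _ a) !b0.
  + by rewrite [lact a _](tens_lactDr a) !bD ex ey.
  + by rewrite [lact a _](tens_lact_pure a) !bP tpure_bal.
- elim/tensor_ind: y => [|x y ex ey|n p]; first by rewrite !b0 addr0.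
  + by rewrite !bD ex ey addrACA.
  + by rewrite !bP !tpureDl.
- exact: bD.
Qed.

Lemma tassocV_bimod_map M N P : bimod_map (@tassocV M N P).
Proof.
have bal (m : M) : balanced (fun (n : N) (p : P) => (m \ox n) \ox p) :=
  tassocV_bal1 N P m.
have b0 (m : M) := tlift0 (bal m); have bD (m : M) := tliftD (bal m).
have bP m n p := tlift_pure n p (bal m).
apply: tlift_bimod_map => [|a m y|m y a]; first exact: tassocV_bal.
- elim/tensor_ind: y => [|x y ex ey|n p]; first by rewrite !b0 lact0r.
  + by rewrite !bD ex ey -(lactDr (bimodP _)).
  + rewrite !bP [RHS](tens_lact_pure a).
    by rewrite [lact a (m \ox n)](tens_lact_pure a).
- elim/tensor_ind: y => [|x y ex ey|n p].
  + by rewrite [ract _ a](tens_ract0 _ _ a) !b0 ract0l.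
  + by rewrite [ract _ a](tens_ractDl a) !bD ex ey -(ractDl (bimodP _)).
  + by rewrite [ract _ a](tens_ract_pure a) !bP [RHS](tens_ract_pure a).
Qed.

End TensorMaps.

Definition castdeg (k : fieldType) (V : nat -> lmodType k) m n (e : m = n) :
  V m -> V n := fun x => ecast i (V i) e x.

(* The graded algebra is the direct sum of its homogeneous components [V n];  *)
(* it is presented externally, by the family of these components.             *)
Record graded_algebra (k : fieldType) (V : nat -> lmodType k) (one : V 0%N)
    (mul : forall i j, V i -> V j -> V (i + j)%N) : Prop := GradedAlgebra {
  gmulDl : forall i j (x x' : V i) (y : V j),
    mul _ _ (x + x') y = mul _ _ x y + mul _ _ x' y;
  gmulDr : forall i j (x : V i) (y y' : V j),
    mul _ _ x (y + y') = mul _ _ x y + mul _ _ x y';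
  gmulZl : forall i j c (x : V i) (y : V j), mul _ _ (c *: x) y = c *: mul _ _ x y;
  gmulZr : forall i j c (x : V i) (y : V j), mul _ _ x (c *: y) = c *: mul _ _ x y;
  gmul1l : forall j (y : V j), mul _ _ one y = y;
  gmul1r : forall i (x : V i), castdeg (addn0 i) (mul _ _ x one) = x;
  gmulA : forall i j l (x : V i) (y : V j) (z : V l),
    castdeg (addnA i j l) (mul _ _ x (mul _ _ y z)) = mul _ _ (mul _ _ x y) z }.

Section DGA.
Variables (k : fieldType) (A : algType k).

Definition forms (F : nat -> bimod A) (n : nat) : bimod A :=
  if n is m.+1 then F m else regular A.

Record dga_axioms (Om : nat -> bimod A) (one : Om 0%N) (incl : A -> Om 0%N)
    (wedge : forall i j, Om i -> Om j -> Om (i + j)%N)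
    (d : forall n, Om n -> Om n.+1) : Prop := DgaAxioms {
  wedge_graded : graded_algebra one wedge;
  wedge0l : forall j a (y : Om j), wedge 0%N j (incl a) y = lact a y;
  wedge0r : forall i (x : Om i) a,
    castdeg (V := Om) (addn0 i) (wedge i 0%N x (incl a)) = ract x a;
  d_linear : forall n, linear (@d n);
  d_d : forall n (x : Om n), d _ (d _ x) = 0;
  d_Leibniz : forall i j (x : Om i) (y : Om j),
    d _ (wedge _ _ x y) = wedge _ _ (d _ x) y
      + (-1) ^+ i *: castdeg (V := Om) (addnS i j) (wedge _ _ x (d _ y));
  (* the smallest graded subalgebra containing [A] and [dA] is everything *)
  generated : forall P : forall n, Om n -> Prop,
    (forall a, P 0%N (incl a)) -> (forall a, P 1%N (d 0%N (incl a))) ->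
    (forall n, P n 0) ->
    (forall n (x y : Om n), P n x -> P n y -> P n (x + y)) ->
    (forall n c (x : Om n), P n x -> P n (c *: x)) ->
    (forall i j (x : Om i) (y : Om j), P i x -> P j y -> P (i + j)%N (wedge _ _ x y)) ->
    forall n (x : Om n), P n x }.

Record dga := Dga {
  pos_forms : nat -> bimod A;
  wedge : forall i j, forms pos_forms i -> forms pos_forms j ->
    forms pos_forms (i + j)%N;
  dd : forall n, forms pos_forms n -> forms pos_forms n.+1;
  dgaP : @dga_axioms (forms pos_forms) (1 : A) id wedge dd }.

Definition dga_deg (Om : dga) : nat -> bimod A := forms (pos_forms Om).
Coercion dga_deg : dga >-> Funclass.

End DGA.

Arguments wedge {k A} d {i j}.
Arguments dd {k A} d {n}.

Section SymmetricForms.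
Variables (k : fieldType) (A : algType k) (Om : dga A).

Definition wedge_map : tens (Om 1%N) (Om 1%N) -> Om 2%N :=
  tlift (fun x y : Om 1%N => wedge Om x y).

(* [tpow n] is the [n]-fold tensor power of [Om 1], bracketed to the right. *)
Fixpoint tpow (n : nat) : bimod A :=
  match n with
  | 0 => regular A
  | m.+1 => match m with 0 => Om 1%N | _.+1 => tens (Om 1%N) (tpow m) end
  end.

(* The identification of [tpow i (x) tpow j] with [tpow (i + j)], on pairs. *)
Fixpoint tcat (i j : nat) : tpow i -> tpow j -> tpow (i + j)%N :=
  match i return tpow i -> tpow j -> tpow (i + j)%N with
  | 0 => fun a y => lact a y
  | m.+1 =>
    match m return (tpow m -> tpow j -> tpow (m + j)%N) ->
                   tpow m.+1 -> tpow j -> tpow (m.+1 + j)%N with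
    | 0 => fun _ =>
        match j return Om 1%N -> tpow j -> tpow j.+1 with
        | 0 => fun x a => ract x a
        | _.+1 => fun x y => x \ox y
        end
    | _.+1 => fun rec x y => tlift (fun (w : Om 1%N) x' => w \ox rec x' y) x
    end (tcat (j := j))
  end.

(* Positions are counted from 0: the maps [sigma_i] and [wedge_i] of the      *)
(* literature, acting on the factors i and i + 1 counted from 1, are          *)
(* [sigma_at n i.-1] and [wedge_at n i.-1]. When [n <= i.+1] there are no     *)
(* such factors and the values are irrelevant.                                *)

Section Sigma.
Variable sigma : tens (Om 1%N) (Om 1%N) -> tens (Om 1%N) (Om 1%N).

Definition sigma_first (p : nat) : tpow p.+2 -> tpow p.+2 :=
  match p return tpow p.+2 -> tpow p.+2 with
  | 0 => sigma
  | q.+1 => fun x => tassoc (tmap sigma (@id (tpow q.+1)) (tassocV x))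
  end.

Fixpoint sigma_at (n i : nat) : tpow n -> tpow n :=
  match n return tpow n -> tpow n with
  | 0 => id
  | m.+1 =>
    match m return (nat -> tpow m -> tpow m) -> tpow m.+1 -> tpow m.+1 with
    | 0 => fun _ => id
    | p.+1 => fun rec =>
        if i is i'.+1 then tmap (@id (Om 1%N)) (rec i') else sigma_first (p := p)
    end (sigma_at (n := m))
  end.

(* [sigma_1 \o ... \o sigma_l] *)
Definition sigma_chain (n l : nat) (x : tpow n) : tpow n :=
  foldr (fun i y => sigma_at i y) x (iota 0 l).

Fixpoint binom (n j : nat) : tpow n -> tpow n :=
  match n return tpow n -> tpow n with
  | 0 => id
  | m.+1 =>
    match m return (nat -> tpow m -> tpow m) -> tpow m.+1 -> tpow m.+1 with
    | 0 => fun _ => id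
    | p.+1 => fun rec x =>
        if (0 < j < p.+2)%N then
          tmap (@id (Om 1%N)) (rec j.-1) (sigma_chain (p.+2 - j) x)
          + tmap (@id (Om 1%N)) (rec j) x
        else x
    end (binom (n := m))
  end.

End Sigma.

Definition wedge_first_cod (p : nat) : bimod A :=
  if p is _.+1 then tens (Om 2%N) (tpow p) else Om 2%N.

Definition wedge_first (p : nat) : tpow p.+2 -> wedge_first_cod p :=
  match p return tpow p.+2 -> wedge_first_cod p with
  | 0 => wedge_map
  | q.+1 => fun x => tmap wedge_map (@id (tpow q.+1)) (tassocV x)
  end.

Fixpoint wedge_cod (n i : nat) : bimod A :=
  match n with
  | 0 => Om 2%N
  | m.+1 => if i is i'.+1 then tens (Om 1%N) (wedge_cod m i')
            else wedge_first_cod m.-1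
  end.

Fixpoint wedge_at (n i : nat) : tpow n -> wedge_cod n i :=
  match n return tpow n -> wedge_cod n i with
  | 0 => fun _ => 0
  | m.+1 =>
    match m return (forall i', tpow m -> wedge_cod m i') ->
                   tpow m.+1 -> wedge_cod m.+1 i with
    | 0 => fun _ _ => 0
    | p.+1 => fun rec =>
        match i return tpow p.+2 -> wedge_cod p.+2 i with
        | 0 => wedge_first (p := p)
        | i'.+1 => tmap (@id (Om 1%N)) (rec i')
        end
    end (wedge_at (n := m))
  end.

Lemma castdeg_id (V : nat -> lmodType k) n (e : n = n) (x : V n) :
  castdeg e x = x.
Proof. by rewrite /castdeg eq_axiomK. Qed.

Lemma wedge_map_bal : balanced (fun x y : Om 1%N => wedge Om x y).
Proof.
have gr := wedge_graded (dgaP Om).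
split=> [x x' y|x y y'|x a y]; first exact: (gmulDl gr).
- exact: (gmulDr gr).
- have := wedge0r (dgaP Om) x a; rewrite castdeg_id => <-.
  rewrite -(wedge0l (dgaP Om)).
  have := gmulA gr x (a : Om 0%N) y; rewrite castdeg_id => <-.
  by [].
Qed.

Lemma wedge_map_bimod_map : bimod_map wedge_map.
Proof.
have gr := wedge_graded (dgaP Om).
apply: tlift_bimod_map => [|a x y|x y a]; first exact: wedge_map_bal.
- rewrite -!(wedge0l (dgaP Om)).
  by have := gmulA gr (a : Om 0%N) x y; rewrite castdeg_id.
- have := wedge0r (dgaP Om) y a; rewrite castdeg_id => <-.
  have := wedge0r (dgaP Om) (wedge Om x y) a; rewrite castdeg_id => <-.
  by have := gmulA gr x y (a : Om 0%N); rewrite castdeg_id.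
Qed.

Lemma wedge_at_bimod_map n i : bimod_map (@wedge_at n i).
Proof.
elim: n i => [|[|p] IH] i; try exact: bimod_map0.
case: i => [|i]; last exact: tmap_bimod_map (@bimod_map_id _ _ _) (IH i).
case: p {IH} => [|q]; first exact: wedge_map_bimod_map.
apply: bimod_map_comp; last exact: tassocV_bimod_map.
exact: tmap_bimod_map wedge_map_bimod_map (@bimod_map_id _ _ _).
Qed.

Definition symmetric_form (n : nat) : {pred tpow n} :=
  [pred x : tpow n | [forall i : 'I_n.-1, wedge_at i x == 0]].
Arguments symmetric_form : clear implicits.

Lemma symmetric_formP n (x : tpow n) :
  reflect (forall i, (i < n.-1)%N -> wedge_at i x = 0) (x \in symmetric_form n).
Proof.
apply: (iffP forallP) => [H i ltin|H i]; last by apply/eqP/H.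
exact/eqP/(H (Ordinal ltin)).
Qed.

Fact symmetric_form_closed n : submod_closed (symmetric_form n).
Proof.
split=> [|c x y /symmetric_formP xs /symmetric_formP ys]; apply/symmetric_formP.
  by move=> i _; rewrite (bmap0 (wedge_at_bimod_map n i)).
move=> i lin; have fb := wedge_at_bimod_map n i.
by rewrite (bmapD fb) (bmapZ fb) xs // ys // scaler0 addr0.
Qed.

HB.instance Definition _ n :=
  GRing.isSubmodClosed.Build k (tpow n) (symmetric_form n) (symmetric_form_closed n).

Definition symform (n : nat) := {x : tpow n | x \in symmetric_form n}.

HB.instance Definition _ n := SubChoice.on (symform n).
HB.instance Definition _ n := [SubChoice_isSubLmodule of symform n by <:].

Lemma symform_lact n (a : A) (x : symform n) :
  lact a (val x) \in symmetric_form n.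
Proof.
apply/symmetric_formP => i lin.
by rewrite (bmap_lact (wedge_at_bimod_map n i)) (symmetric_formP _ (valP x)) ?lact0r.
Qed.

Lemma symform_ract n (x : symform n) (a : A) :
  ract (val x) a \in symmetric_form n.
Proof.
apply/symmetric_formP => i lin.
by rewrite (bmap_ract (wedge_at_bimod_map n i)) (symmetric_formP _ (valP x)) ?ract0l.
Qed.

Lemma symform_axioms n : @bimod_axioms k A (GRing.Lmodule.clone k (symform n) _)
  (fun a x => Sub (lact a (val x)) (symform_lact a x))
  (fun x a => Sub (ract (val x) a) (symform_ract x a)).
Proof.
have B := bimodP (tpow n).
split=> *; apply: val_inj; rewrite /= ?(raddfD, linearZ) /=.
- exact: (lactDl B).
- exact: (lactDr B).
- exact: (lactM B).
- exact: (lact1 B).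
- exact: (ractDl B).
- exact: (ractDr B).
- exact: (ractM B).
- exact: (ract1 B).
- exact: (lractA B).
- exact: (lactZ B).
- exact: (ractZ B).
Qed.

Definition OmS (n : nat) : bimod A := Bimod (symform_axioms n).

Fact symform_one_subproof : (1 : A) \in symmetric_form 0.
Proof. by apply/symmetric_formP. Qed.

Definition OmS_one : OmS 0 := exist _ (1 : A) symform_one_subproof.

Definition OmS_val (n : nat) (x : OmS n) : tpow n := val x.

End SymmetricForms.

Section Connections.
Variables (k : fieldType) (A : algType k) (Om : dga A).

Record bimodule_connection (E : bimod A) (nabla : E -> tens (Om 1%N) E)
    (sigma : tens E (Om 1%N) -> tens (Om 1%N) E) : Prop := BimoduleConnection {
  conn_linear : linear nabla;
  conn_sigma : bimod_map sigma;
  conn_lact : forall (a : Om 0%N) (x : E),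
    nabla (lact a x) = dd Om a \ox x + lact a (nabla x);
  conn_ract : forall (x : E) (a : Om 0%N),
    nabla (ract x a) = ract (nabla x) a + sigma (x \ox dd Om a) }.

Variables (nabla : Om 1%N -> tens (Om 1%N) (Om 1%N))
          (sigma : tens (Om 1%N) (Om 1%N) -> tens (Om 1%N) (Om 1%N)).

Definition torsion_free : Prop := forall x : Om 1%N, wedge_map (nabla x) = dd Om x.

(* The right hand side is [(nabla x) /\ y + wedge_2 (sigma_1 (x (x) nabla y))]. *)
Definition wedge_compatible : Prop :=
  exists (nabla2 : Om 2%N -> tens (Om 1%N) (Om 2%N))
         (sigma2 : tens (Om 2%N) (Om 1%N) -> tens (Om 1%N) (Om 2%N)),
    bimodule_connection nabla2 sigma2 /\
    forall x y : Om 1%N, nabla2 (wedge Om x y) =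
      tmap id (@wedge_map k A Om) (tassoc (nabla x \ox y))
      + wedge_at (n := 3) 1 (sigma_at sigma (n := 3) 0 (x \ox nabla y)).

Definition extendable : Prop :=
  exists2 s : tens (Om 1%N) (Om 2%N) -> tens (Om 2%N) (Om 1%N), bimod_map s &
    forall x y z : Om 1%N, s (x \ox wedge Om y z) =
      wedge_at (n := 3) 0
        (sigma_at sigma (n := 3) 1 (sigma_at sigma (n := 3) 0 (x \ox (y \ox z)))).

Definition braid_relation : Prop := forall x : tpow Om 3,
  sigma_at sigma 0 (sigma_at sigma 1 (sigma_at sigma 0 x)) =
  sigma_at sigma 1 (sigma_at sigma 0 (sigma_at sigma 1 x)).

End Connections.

(* Main.v *)
Require Import Defs.
From mathcomp Require Import all_boot all_order all_algebra.
From mathcomp Require Import zify.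

Set Implicit Arguments.
Unset Strict Implicit.
Unset Printing Implicit Defensive.

Import GRing.Theory.
Local Open Scope ring_scope.

(** The braided binomial [i+j over j] is the sum, over all shuffles of a word
    of i letters with a word of j letters, of the corresponding positive braids
    evaluated through sigma: the next output letter is either the first letter
    of the left word, or the first letter of the right word pulled to the front
    past the whole left word by a chain [sigma_1 ... sigma_i].  Writing it as an
    operator [shuf i j p] that acts on the letters p, ..., p + i + j - 1 of a
    word of any length turns both halves of the theorem into statements about
    additive operators [s_0, s_1, ...] on a single abelian group.

    Associativity ([shufA]).  Expand both threefold products according to which
    of the three words supplies the first output letter; the three resulting
    pairs of terms agree by induction.  This uses that a chain passing to the
    front through a whole word commutes with shuffling that word, which is the
    braid relation ([chain_shuf]), and that pulling a letter past two words is
    pulling it past the second and then past the first ([chainD]).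

    Symmetry of the product ([ker_shuf]).  Let x lie in the kernels of all
    wedge_a except the one at the junction of the two words.  To see that
    wedge_p kills the shuffle, look at its first two output letters.  If both
    come from the left word, wedge_p meets two neighbours of that word.  If both
    come from the right word, wedge_p moves through their two parallel chains
    back to two neighbours of the right word, because
    wedge_a sigma_(a+1) sigma_a is a function of wedge_(a+1) (extendability).
    If they come from different words, the two orders pair up to a term
    (1 + sigma_p) z, and wedge (1 + sigma) = 0 by torsion freeness.  Later
    positions follow by induction, once a wedge inside the left word has been
    moved through a chain, because wedge_(a+1) sigma_a sigma_(a+1) is a function
    of wedge_a (wedge-compatibility).

    The kernels are not compatible with tensoring over A: an element of the
    kernel of id (x) f need not be a combination of w (x) y with f y = 0.
    Hence the relations between the wedges and sigma are proved as
    factorizations of operators ([wedge_factors]), which do survive id (x) -,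
    and the offset p in [shuf] makes the induction run inside one fixed tensor
    power, where only elements killed by given wedges matter. *)

(** * Shuffle operators *)

Section Shuffle.
Variables (V : zmodType) (s : nat -> V -> V).

Definition chain (p l : nat) (x : V) : V := foldr s x (iota p l).

(** The sum of the positive braids lifting the (i, j)-shuffles of the letters
    p, ..., p + i + j - 1: the first output letter is the first left letter, or
    the first right letter brought to position p by [chain p i]. *)
Fixpoint shuf (i : nat) : nat -> nat -> V -> V :=
  match i with
  | 0 => fun _ _ x => x
  | i'.+1 => fix rec j p x :=
      if j is j'.+1 then shuf i' j p.+1 x + rec j' p.+1 (chain p i x) else x
  end.

Lemma shufn0 i p x : shuf i 0 p x = x. Proof. by case: i. Qed.

Lemma shufSS i j p x : shuf i.+1 j.+1 p x =
  shuf i j.+1 p.+1 x + shuf i.+1 j p.+1 (chain p i.+1 x).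
Proof. by []. Qed.

Lemma chain0 p x : chain p 0 x = x. Proof. by []. Qed.

Lemma chainS p l x : chain p l.+1 x = s p (chain p.+1 l x).
Proof. by []. Qed.

Lemma chainD p l m x : chain p (l + m) x = chain p l (chain (p + l) m x).
Proof. by rewrite /chain iotaD foldr_cat. Qed.

Lemma chain_closed (K : V -> Prop) p l :
    (forall a x, (p <= a < p + l)%N -> K x -> K (s a x)) ->
  forall x, K x -> K (chain p l x).
Proof.
elim: l p => [//|l IH] p Ks x Kx; rewrite chainS.
apply: (Ks); first lia.
by apply: IH => // a y pa; apply: Ks; lia.
Qed.

Lemma shuf_closed (K : V -> Prop) i j p :
    (forall x y, K x -> K y -> K (x + y)) ->
    (forall a x, (p <= a)%N -> (a.+1 < p + i + j)%N -> K x -> K (s a x)) ->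
  forall x, K x -> K (shuf i j p x).
Proof.
move=> KD; elim: i j p => [//|i IHi] j; elim: j => [//|j IHj] p Ks x Kx.
rewrite shufSS; apply: KD.
  by apply: IHi => // a y *; apply: Ks => //; lia.
apply: IHj; first by move=> a y *; apply: Ks => //; lia.
by apply: chain_closed => // a y *; apply: Ks => //; lia.
Qed.

End Shuffle.

Section ShuffleMorphism.
Variables (V W : zmodType) (s : nat -> V -> V) (t : nat -> W -> W).
Variables (f : V -> W) (c : nat).

Lemma chain_morph p l :
    (forall a x, (p <= a < p + l)%N -> f (s a x) = t (c + a) (f x)) ->
  forall x, f (chain s p l x) = chain t (c + p) l (f x).
Proof.
elim: l p => [//|l IH] p fs x.
rewrite !chainS fs; last lia.
by rewrite IH ?addnS // => a y pa; apply: fs; lia.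
Qed.

(** Carries shuffles along every map that intertwines the generators up to a
    shift of positions by c, possibly between tensor powers of different
    length: concatenation with a word on either side, the module actions, and
    a chain passing over the shuffled letters are all of this form. *)
Lemma shuf_morph i j p :
    {morph f : x y / x + y} ->
    (forall a x, (p <= a)%N -> (a.+1 < p + i + j)%N ->
       f (s a x) = t (c + a) (f x)) ->
  forall x, f (shuf s i j p x) = shuf t i j (c + p) (f x).
Proof.
move=> fD; elim: i j p => [//|i IHi] j; elim: j => [//|j IHj] p fs x.
rewrite !shufSS fD IHi; last by move=> a y *; apply: fs; lia.
rewrite IHj; last by move=> a y *; apply: fs; lia.
rewrite chain_morph ?addnS // => a y *; apply: fs; lia.
Qed.

End ShuffleMorphism.

(** * Associativity from the braid relations *)

Section BraidedShuffle.
Variables (V : zmodType) (s : nat -> V -> V) (N : nat).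
Hypothesis sD : forall a, {morph s a : x y / x + y}.
Hypothesis s_far : forall a b x, (a.+1 < b)%N -> (b < N)%N ->
  s a (s b x) = s b (s a x).
Hypothesis s_braid : forall a x, (a.+1 < N)%N ->
  s a (s a.+1 (s a x)) = s a.+1 (s a (s a.+1 x)).

Lemma chain_add p l : {morph chain s p l : x y / x + y}.
Proof. by elim: l p => [//|l IH] p x y; rewrite !chainS IH sD. Qed.

Lemma shuf_add i j p : {morph shuf s i j p : x y / x + y}.
Proof.
elim: i j p => [//|i IHi] j; elim: j => [//|j IHj] p x y.
by rewrite !shufSS chain_add IHi IHj addrACA.
Qed.

Lemma chain_far b p l x : (p + l < b)%N -> (b < N)%N ->
  chain s p l (s b x) = s b (chain s p l x).
Proof.
move=> plb bN; symmetry; apply: (@chain_morph V V s s (s b) 0%N) => a y pa.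
by rewrite add0n -s_far //; lia.
Qed.

Lemma chain_farr b p l x : (b.+1 < p)%N -> (p + l <= N)%N ->
  chain s p l (s b x) = s b (chain s p l x).
Proof.
move=> bp pl; symmetry; apply: (@chain_morph V V s s (s b) 0%N) => a y pa.
by rewrite add0n s_far //; lia.
Qed.

(** The chain drags one strand over all the others, so a crossing of two
    neighbours slides through it and moves by one position. *)
Lemma chain_braid p l a x : (p <= a)%N -> (a.+1 < p + l)%N -> (p + l <= N)%N ->
  chain s p l (s a x) = s a.+1 (chain s p l x).
Proof.
move=> pa al lN.
(* isolate the factors s_a s_(a+1) of the chain, where the crossing acts *)
have -> : l = ((a - p) + (2 + (l - (a - p) - 2)))%N by lia.
set m := (l - _ - 2)%N.
rewrite !chainD subnKC // addn2 !chainS !chain0 (@chain_farr a a.+2); [|lia..].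
by rewrite s_braid; [rewrite chain_far; [|lia..] | lia].
Qed.

Lemma chain_shuf p l q i j x :
    (p <= q)%N -> (q + i + j <= p + l)%N -> (p + l <= N)%N ->
  chain s p l (shuf s i j q x) = shuf s i j q.+1 (chain s p l x).
Proof.
move=> pq qij lN; apply: (@shuf_morph V V s s (chain s p l) 1%N).
  exact: chain_add.
by move=> a y *; rewrite chain_braid //; lia.
Qed.

(** Both sides are the sum over all shuffles of three words; the three summands
    in the middle of the proof collect the terms whose first letter comes from
    the first, the second and the third word. *)
Theorem shufA i j l p x : (p + i + j + l <= N.+1)%N ->
  shuf s (i + j) l p (shuf s i j p x) =
  shuf s i (j + l) p (shuf s j l (p + i) x).
Proof.
elim: i j l p x => [|i IHi] j l p x; first by rewrite addn0.
elim: j l p x => [|j IHj] l p x; first by rewrite !addn0 add0n !shufn0.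
elim: l p x => [|l IHl] p x; first by rewrite !shufn0 !addn0.
move=> le_N; set c := chain s p i.+1 x.
have chain_z i' j' x' : (p + i.+2 + i' + j' <= N.+1)%N ->
    chain s p i.+1 (shuf s i' j' (p + i.+2) x') =
    shuf s i' j' (p + i.+2) (chain s p i.+1 x').
  move=> le_N'; apply: (@shuf_morph V V s s (chain s p i.+1) 0%N).
    exact: chain_add.
  by move=> a y' *; rewrite chain_far //; lia.
transitivity (shuf s i (j.+1 + l.+1) p.+1 (shuf s j.+1 l.+1 (p + i.+1) x)
  + (shuf s i.+1 (j + l.+1) p.+1 (shuf s j l.+1 (p + i.+2) c)
     + shuf s i.+1 (j + l.+1) p.+1
         (shuf s j.+1 l (p + i.+2) (chain s p (i.+1 + j.+1) x)))).
  rewrite (addSn i) [LHS]shufSS -{2 3}(addSn i) chain_shuf //; [|lia..].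
  rewrite [in X in X + _ = _](shufSS s i j p) shuf_add -addrA.
  congr (_ + (_ + _)).
  - by rewrite IHi; [rewrite (addSnnS p)|lia].
  - by rewrite -(addSnnS i) IHj; [rewrite (addSnnS p)|lia].
  - by rewrite -(addSnnS j l) IHl; [rewrite (addSnnS p)|lia].
rewrite [RHS]shufSS; congr (_ + _).
rewrite -shuf_add shufSS -addnS chain_add !chain_z; [|lia..].
by rewrite -chainD.
Qed.

End BraidedShuffle.

(** * Shuffles of words killed by wedges *)

Section SymmetricClosure.
Variables (V : zmodType) (s : nat -> V -> V) (N : nat).
Hypothesis sD : forall a, {morph s a : x y / x + y}.
Hypothesis s_far : forall a b x, (a.+1 < b)%N -> (b < N)%N ->
  s a (s b x) = s b (s a x).

(* K a x stands for: the wedge of the letters a and a + 1 kills x. *)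
Variable K : nat -> V -> Prop.
Hypothesis K0 : forall a, K a 0.
Hypothesis KD : forall a x y, K a x -> K a y -> K a (x + y).
Hypothesis K_far : forall a b x, (a.+1 < b)%N || (b.+1 < a)%N ->
  (a < N)%N -> (b < N)%N -> K a x -> K a (s b x).
Hypothesis K_up : forall a x, (a.+1 < N)%N ->
  K a x -> K a.+1 (s a (s a.+1 x)).
Hypothesis K_down : forall a x, (a.+1 < N)%N ->
  K a.+1 x -> K a (s a.+1 (s a x)).
Hypothesis K_anti : forall a x, (a < N)%N -> K a (x + s a x).

Lemma ker_chain_far a p l x : (a.+1 < p)%N || (p + l < a)%N ->
  (a < N)%N -> (p + l <= N)%N -> K a x -> K a (chain s p l x).
Proof.
by move=> pla aN lN; apply: chain_closed => b y *; apply: K_far => //; lia.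
Qed.

Lemma ker_shuf_far a p i j x : (a.+1 < p)%N -> (p + i + j <= N.+1)%N ->
  (a < N)%N -> K a x -> K a (shuf s i j p x).
Proof.
move=> ap ijN aN; apply: shuf_closed; first exact: KD.
by move=> b y *; apply: K_far => //; lia.
Qed.

(** A wedge inside the word crossed by the chain slides back through the
    chain by [K_up], to the pair one position earlier.  The pair at p + l is
    excluded because it consists of the last letter crossed and the letter
    behind the moved one, which were not neighbours before the move. *)
Lemma ker_chain p l a x : (p < a)%N -> (a < N)%N -> (p + l <= N)%N ->
    (forall b, (p <= b <= a)%N -> b.+1 != p + l -> K b x) ->
  a != (p + l)%N -> K a (chain s p l x).
Proof.
move=> pa aN lN Kx apl; have [la|al] := ltnP (p + l) a.
  by apply: ker_chain_far => //; [lia|apply: Kx; lia].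
have -> : l = (a.-1 - p + (2 + (p + l - a.+1)))%N by lia.
rewrite !chainD addn2 (_ : p + (a.-1 - p) = a.-1)%N ?chainS ?chain0; last lia.
have {}Kx : K a.-1 x by apply: Kx; lia.
case: a => [//|a] /= in pa aN Kx apl al *.
apply: ker_chain_far; [lia|lia|lia|].
by apply: K_up => //; apply: ker_chain_far; [lia|lia|lia|].
Qed.

(** Two successive chains bring two adjacent letters from p + m, p + m + 1 to
    p, p + 1; interleaving the chains shows m instances of [K_down]. *)
Lemma ker_chain2 p m x : (p + m < N)%N ->
  K (p + m) x -> K p (chain s p.+1 m (chain s p m x)).
Proof.
elim: m p => [|m IH] p; first by rewrite addn0.
move=> mN; rewrite -addSnnS => Kx; rewrite !chainS.
have -> : chain s p.+2 m (s p (chain s p.+1 m x)) =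
    s p (chain s p.+2 m (chain s p.+1 m x)).
  symmetry; apply: (@chain_morph V V s s (s p) 0%N) => a y pa.
  by rewrite s_far //; lia.
by apply: K_down; [lia|apply: IH; [lia|]].
Qed.

(** The pair with a + 1 = p + i straddles the two words, and nothing is assumed
    of it. *)
Theorem ker_shuf p i j x : (p + i + j <= N.+1)%N ->
    (forall a, (p <= a)%N -> (a.+1 < p + i + j)%N -> a.+1 != (p + i)%N -> K a x) ->
  forall a, (p <= a)%N -> (a.+1 < p + i + j)%N -> K a (shuf s i j p x).
Proof.
elim: i j p x => [|i IHi] j p x ijN Kx a pa aij.
  by apply: Kx => //; lia.
elim: j p x a ijN Kx pa aij => [|j IHj] p x a ijN Kx pa aij.
  by apply: Kx => //; lia.
case: (ltngtP p a) pa => // [lt_pa|eq_pa] _.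
  rewrite shufSS; apply: KD.
    by apply: IHi => [|b *||]; [lia|apply: (Kx); lia|lia|lia].
  apply: IHj => [|b pb bij b_neq||]; [lia| |lia|lia].
  apply: ker_chain; [lia|lia|lia| |lia].
  by move=> e pe e_neq; apply: Kx; lia.
rewrite -eq_pa shufSS; set y := chain s p i.+1 x.
(* Split off the second output letter as well: r has both letters from the
   left word and t both from the right one, while the two mixed terms share
   the operator shuf i j p.+2. *)
have [r Kr ->] : exists2 r, K p r &
    shuf s i j.+1 p.+1 x = r + shuf s i j p.+2 (chain s p.+1 i x).
  case: (i) ijN Kx aij => [|i'] ijN Kx aij; first by exists 0; rewrite ?add0r.
  exists (shuf s i' j.+1 p.+2 x); last exact: shufSS.
  by apply: ker_shuf_far; [lia|lia|lia|apply: Kx; lia].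
have [t Kt ->] : exists2 t, K p t &
    shuf s i.+1 j p.+1 y = t + shuf s i j p.+2 y.
  case: (j) ijN Kx aij => [|j'] ijN Kx aij.
    by exists 0; rewrite ?add0r ?shufn0.
  exists (shuf s i.+1 j' p.+2 (chain s p.+1 i.+1 y)); last first.
    by rewrite shufSS addrC.
  apply: ker_shuf_far; [lia|lia|lia|].
  by apply: ker_chain2; [lia|apply: Kx; lia].
rewrite addrACA -shuf_add //; apply: KD; first exact: KD.
by apply: ker_shuf_far; [lia|lia|lia|apply: K_anti; lia].
Qed.

End SymmetricClosure.

(** * Tensor products and left linear maps *)

Section TensorCalculus.
Variables (k : fieldType) (A : algType k).
Implicit Types M N P : bimod A.

Lemma lact_pure M N a (m : M) (n : N) : lact a (m \ox n) = lact a m \ox n.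
Proof. exact: tens_lact_pure. Qed.

Lemma ract_pure M N a (m : M) (n : N) : ract (m \ox n) a = m \ox ract n a.
Proof. exact: tens_ract_pure. Qed.

Lemma ox_bal M N a (m : M) (n : N) : ract m a \ox n = m \ox lact a n.
Proof. exact: tpure_bal. Qed.

Lemma oxDl M N (m m' : M) (n : N) : (m + m') \ox n = m \ox n + m' \ox n.
Proof. exact: tpureDl. Qed.

Lemma oxDr M N (m : M) (n n' : N) : m \ox (n + n') = m \ox n + m \ox n'.
Proof. exact: tpureDr. Qed.

Lemma tens_ind M N (P : tens M N -> Prop) :
    P 0 -> (forall x y, P x -> P y -> P (x + y)) ->
    (forall m n, P (m \ox n)) -> forall x, P x.
Proof. exact: tensor_ind. Qed.

Lemma additive0 (U W : zmodType) (f : U -> W) :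
  {morph f : x y / x + y} -> f 0 = 0.
Proof. by move=> fD; apply: (@addrI _ (f 0)); rewrite -fD !addr0. Qed.

Lemma ox0 M N (m : M) : m \ox (0 : N) = 0.
Proof. by apply: (@additive0 _ _ (fun n : N => m \ox n)) => x y; apply: oxDr. Qed.

Lemma ox0l M N (n : N) : (0 : M) \ox n = 0.
Proof. by apply: (@additive0 _ _ (fun m : M => m \ox n)) => x y; apply: oxDl. Qed.

Lemma tens_ext M N (W : zmodType) (f g : tens M N -> W) :
    {morph f : x y / x + y} -> {morph g : x y / x + y} ->
    (forall m n, f (m \ox n) = g (m \ox n)) ->
  f =1 g.
Proof.
move=> fD gD fg x; elim/tens_ind: x => [|x y fx fy|m n]; last exact: fg.
  by rewrite !additive0.
by rewrite fD gD fx fy.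
Qed.

(** What a map g must satisfy for id (x) g to be defined over A.  Asking for a
    bimodule map would be too much: appending a fixed word on the right is not
    right linear. *)
Record left_linear M N (f : M -> N) : Prop := LeftLinear {
  llinD : {morph f : x y / x + y};
  llin_lact : forall a x, f (lact a x) = lact a (f x) }.

Lemma bimod_left_linear M N (f : M -> N) : bimod_map f -> left_linear f.
Proof. by move=> fb; split; [apply: bmapD | apply: bmap_lact]. Qed.

Lemma idtmap_bal M N N' (g : N -> N') : left_linear g ->
  balanced (fun (m : M) n => id m \ox g n).
Proof.
move=> gl; split=> [m m' n|m n n'|m a n].
- exact: tpureDl.
- by rewrite (llinD gl) tpureDr.
- by rewrite (llin_lact gl) tpure_bal.
Qed.

Lemma idtmap_pure M N N' (g : N -> N') (m : M) n : left_linear g ->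
  tmap id g (m \ox n) = m \ox g n.
Proof. by move=> gl; rewrite /tmap tlift_pure //; apply: idtmap_bal. Qed.

Lemma idtmap_left_linear M N N' (g : N -> N') : left_linear g ->
  left_linear (tmap (@id M) g).
Proof.
move=> gl; have gD : {morph tmap (@id M) g : x y / x + y}.
  exact: (tliftD (idtmap_bal M gl)).
split=> [x y|a x]; first exact: gD.
elim/tens_ind: x => [|x y ex ey|m n].
- by rewrite [lact a _]lact0r (additive0 gD) lact0r.
- by rewrite (lactDr (bimodP _)) [LHS]gD ex ey -(lactDr (bimodP _)) -gD.
- by rewrite lact_pure !idtmap_pure // lact_pure.
Qed.

Lemma tmap_pure M M' N N' (f : M -> M') (g : N -> N') m n :
  bimod_map f -> bimod_map g -> tmap f g (m \ox n) = f m \ox g n.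
Proof. by move=> fb gb; rewrite /tmap tlift_pure //; apply: tmap_bal. Qed.

Lemma tassocV_pure M N P (m : M) (n : N) (p : P) :
  tassocV (m \ox (n \ox p)) = (m \ox n) \ox p.
Proof.
rewrite /tassocV tlift_pure; last exact: tassocV_bal.
by rewrite tlift_pure //; apply: tassocV_bal1.
Qed.

Lemma tassoc_bal1 M N P (p : P) :
  balanced (fun (m : M) (n : N) => m \ox (n \ox p)).
Proof.
split=> [m m' n|m n n'|m a n]; first exact: tpureDl.
- by rewrite tpureDl tpureDr.
- by rewrite -lact_pure -tpure_bal.
Qed.

Lemma tassoc_bal M N P : balanced (fun (x : tens M N) (p : P) =>
  tlift (fun (m : M) (n : N) => m \ox (n \ox p)) x).
Proof.
have bal p := tassoc_bal1 M N (p : P).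
split=> [x x' p|x p p'|x a p]; first exact: tliftD.
- elim/tens_ind: x => [|x y ex ey|m n].
  + by rewrite !tlift0 ?addr0.
  + by rewrite !tliftD // ex ey addrACA.
  + by rewrite !tlift_pure // oxDr oxDr.
- elim/tens_ind: x => [|x y ex ey|m n].
  + by rewrite ract0l !tlift0.
  + by rewrite (ractDl (bimodP _)) !tliftD // ex ey.
  + by rewrite ract_pure !tlift_pure // ox_bal.
Qed.

Lemma tassoc_pure M N P (m : M) (n : N) (p : P) :
  tassoc ((m \ox n) \ox p) = m \ox (n \ox p).
Proof.
rewrite /tassoc tlift_pure; last exact: tassoc_bal.
by rewrite tlift_pure //; apply: tassoc_bal1.
Qed.

Lemma tassoc_bimod_map M N P : bimod_map (@tassoc k A M N P).
Proof.
have bal p := tassoc_bal1 M N (p : P).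
apply: tlift_bimod_map => [|a x p|x p a]; first exact: tassoc_bal.
- elim/tens_ind: x => [|x y ex ey|m n].
  + by rewrite lact0r !tlift0 // lact0r.
  + by rewrite (lactDr (bimodP _)) !tliftD // ex ey -(lactDr (bimodP _)).
  + by rewrite lact_pure !tlift_pure // lact_pure.
- elim/tens_ind: x => [|x y ex ey|m n].
  + by rewrite !tlift0 // ract0l.
  + by rewrite !tliftD // ex ey -(ractDl (bimodP _)).
  + by rewrite !tlift_pure // ract_pure ract_pure.
Qed.

Lemma tassocVK M N P : cancel (@tassoc k A M N P) (@tassocV k A M N P).
Proof.
move=> x; have aD := bmapD (tassoc_bimod_map M N P).
have vD := bmapD (tassocV_bimod_map M N P).
elim/tens_ind: x => [|x y ex ey|u p].
- by rewrite (additive0 aD) (additive0 vD).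
- by rewrite [tassoc _]aD [LHS]vD ex ey.
elim/tens_ind: u => [|x y ex ey|m n].
- by rewrite ox0l (additive0 aD) (additive0 vD).
- by rewrite oxDl [tassoc _]aD [LHS]vD ex ey.
- by rewrite tassoc_pure tassocV_pure.
Qed.

(** With words bracketed to the right, a map on the first two letters acts on a
    longer word as f (x) id conjugated by the associator. *)
Definition tmap2 M N M' N' P (f : tens M N -> tens M' N') :
    tens M (tens N P) -> tens M' (tens N' P) :=
  fun x => tassoc (tmap f id (tassocV x)).

Lemma tmap2_bimod_map M N M' N' P (f : tens M N -> tens M' N') :
  bimod_map f -> bimod_map (tmap2 (P := P) f).
Proof.
move=> fb; apply: bimod_map_comp (@tassoc_bimod_map _ _ _) _.
apply: bimod_map_comp (@tassocV_bimod_map _ _ _ _ _).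
exact: tmap_bimod_map fb (@bimod_map_id _ _ _).
Qed.

Lemma tmap2_tassoc M N M' N' P (f : tens M N -> tens M' N') u (p : P) :
  bimod_map f -> tmap2 f (tassoc (u \ox p)) = tassoc (f u \ox p).
Proof.
move=> fb; rewrite /tmap2 tassocVK tmap_pure //; exact: bimod_map_id.
Qed.

Lemma idtmap2_tassoc (M N P P' : bimod A) (f : P -> P') (u : tens M N) p :
  left_linear f ->
  tmap (@id M) (tmap (@id N) f) (tassoc (u \ox p)) = tassoc (u \ox f p).
Proof.
move=> fl; have iD := llinD (idtmap_left_linear M (idtmap_left_linear N fl)).
have aD := bmapD (tassoc_bimod_map M N P).
have aD' := bmapD (tassoc_bimod_map M N P').
elim/tens_ind: u => [|u u' e e'|m n].
- by rewrite !ox0l (additive0 aD) (additive0 aD') (additive0 iD).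
- by rewrite !oxDl aD aD' iD e e'.
- rewrite !tassoc_pure idtmap_pure ?idtmap_pure //.
  exact: idtmap_left_linear.
Qed.

End TensorCalculus.

(** * Concatenation of words *)

Section Concatenation.
Variables (k : fieldType) (A : algType k) (Om : dga A).
Notation V := (Om 1%N).
Notation T := (tpow Om).

Lemma tcat_left_linear i j (y : T j) :
  left_linear (fun x : T i => tcat x y).
Proof.
elim: i => [|[|i] IH];
  last exact: (@idtmap_left_linear k A V (T i.+1) (T (i.+1 + j)) _ IH).
  split=> [a b|a b] /=; first exact: (lactDl (bimodP _)).
  exact: (lactM (bimodP _)).
case: j y {IH} => [|j] y; split=> [a b|a b] /=.
- exact: (ractDl (bimodP _)).
- by rewrite -(lractA (bimodP _)).
- exact: oxDl.
- by symmetry; apply: lact_pure.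
Qed.

Lemma tcat_pure i j (w : V) (x : T i.+1) (y : T j) :
  tcat (w \ox x : T i.+2) y = w \ox tcat x y.
Proof.
exact: (@idtmap_pure k A V (T i.+1) (T (i.+1 + j)) _ w x (tcat_left_linear _ y)).
Qed.

Lemma tcatDl i j (x x' : T i) (y : T j) : tcat (x + x') y = tcat x y + tcat x' y.
Proof. exact: (llinD (tcat_left_linear _ y)). Qed.

Lemma tcat0l i j (y : T j) : tcat (0 : T i) y = 0.
Proof. exact: (additive0 (llinD (tcat_left_linear _ y))). Qed.

Lemma tcat_lact i j a (x : T i) (y : T j) : tcat (lact a x) y = lact a (tcat x y).
Proof. exact: (llin_lact (tcat_left_linear _ y)). Qed.

Lemma tpow_ind i (P : T i.+2 -> Prop) :
    P 0 -> (forall x y, P x -> P y -> P (x + y)) ->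
    (forall (w : V) (x : T i.+1), P (w \ox x)) -> forall x, P x.
Proof. exact: tens_ind. Qed.

Lemma tcatDr i j (x : T i) (y y' : T j) : tcat x (y + y') = tcat x y + tcat x y'.
Proof.
elim: i x => [|[|i] IH] x; first exact: (lactDr (bimodP _)).
  by case: j y y' {IH} => [|j] y y'; [apply: (ractDr (bimodP _)) | apply: oxDr].
elim/tpow_ind: x => [|x x' ex ex'|w x]; first by rewrite !tcat0l addr0.
  by rewrite !tcatDl ex ex' addrACA.
by rewrite !tcat_pure IH oxDr.
Qed.

Lemma tcat_ract i j a (x : T i) (y : T j) : tcat x (ract y a) = ract (tcat x y) a.
Proof.
elim: i x => [|[|i] IH] x; first exact: (lractA (bimodP _)).
  case: j y {IH} => [|j] y; first exact: (ractM (bimodP _)).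
  by rewrite [RHS]ract_pure.
elim/tpow_ind: x => [|x x' ex ex'|w x]; first by rewrite !tcat0l ract0l.
  by rewrite !tcatDl ex ex' (ractDl (bimodP _)).
by rewrite !tcat_pure IH [RHS]ract_pure.
Qed.

Lemma tcat_bal i j a (x : T i) (y : T j) : tcat (ract x a) y = tcat x (lact a y).
Proof.
elim: i x => [|[|i] IH] x; first exact: (lactM (bimodP _)).
  case: j y {IH} => [|j] y; last exact: ox_bal.
  by rewrite /= (ractM (bimodP _)).
elim/tpow_ind: x => [|x x' ex ex'|w x]; first by rewrite ract0l !tcat0l.
  by rewrite (ractDl (bimodP _)) !tcatDl ex ex'.
by rewrite ract_pure !tcat_pure IH.
Qed.

(** Reduces identities between operators that act on the first i letters only
    to the i-th tensor power. *)
Lemma tcat_ind i j (P : T (i + j)%N -> Prop) :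
    P 0 -> (forall x y, P x -> P y -> P (x + y)) ->
    (forall (x : T i) (y : T j), P (tcat x y)) -> forall x, P x.
Proof.
elim: i P => [|[|i] IH] P P0 PD Pt.
- by move=> x; rewrite -(lact1 (bimodP _) x); apply: (Pt 1).
- case: j P P0 PD Pt {IH} => [|j] P P0 PD Pt; last exact: (tens_ind P0 PD Pt).
  by move=> x; rewrite -(ract1 (bimodP _) x); apply: (Pt x 1).
- apply: (tens_ind P0 PD) => w; apply: IH => [|x y|x y].
  + by rewrite ox0.
  + by rewrite oxDr; apply: PD.
  + by rewrite -tcat_pure; apply: Pt.
Qed.

Lemma tcat2 j (u : T 2) (y : T j.+1) : tcat u y = tassoc (u \ox y).
Proof.
elim/tpow_ind: u => [|u u' e e'|w x].
- by rewrite tcat0l ox0l (bmap0 (tassoc_bimod_map _ _ _)).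
- by rewrite tcatDl oxDl (bmapD (tassoc_bimod_map _ _ _)) e e'.
- by rewrite tcat_pure tassoc_pure.
Qed.

Lemma tcat2_0 (u : T 2) (a : T 0) : tcat u a = ract u a.
Proof.
elim/tpow_ind: u => [|u u' e e'|w x].
- by rewrite tcat0l ract0l.
- by rewrite tcatDl (ractDl (bimodP _)) e e'.
- by rewrite tcat_pure ract_pure.
Qed.

Lemma tcat_tassoc i j (u : T 2) (x : T i.+1) (y : T j) :
  tcat (tassoc (u \ox x) : T i.+3) y = tassoc (u \ox tcat x y).
Proof.
elim/tpow_ind: u => [|u u' e e'|w w'].
- by rewrite !ox0l (bmap0 (tassoc_bimod_map _ _ _)) tcat0l
             (bmap0 (tassoc_bimod_map _ _ _)).
- by rewrite !oxDl !(bmapD (tassoc_bimod_map _ _ _)) tcatDl e e'.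
- by rewrite !tassoc_pure !tcat_pure.
Qed.

Lemma tpow_ind2 i (P : T i.+3 -> Prop) :
    P 0 -> (forall x y, P x -> P y -> P (x + y)) ->
    (forall (u : T 2) (x : T i.+1), P (tassoc (u \ox x))) -> forall x, P x.
Proof.
move=> P0 PD Pt; apply: (tens_ind P0 PD) => w.
apply: tens_ind => [|x y|w' x]; first by rewrite ox0.
  by rewrite oxDr; apply: PD.
by have := Pt (w \ox w') x; rewrite tassoc_pure.
Qed.

(* One equation is for the word w x and one for its tail x; successors keep
   both lengths in the range where a tensor power is a genuine tensor product. *)
Lemma castdeg_ox m n (e : m.+2 = n.+2) (e' : m.+1 = n.+1) (w : V) (x : T m.+1) :
  castdeg (V := T) e (w \ox x) = w \ox castdeg (V := T) e' x.
Proof.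
by case: (e') => mn; move: e e' x; rewrite mn => e e' x; rewrite !castdeg_id.
Qed.

Lemma castdegD m n (e : m = n) :
  {morph castdeg (V := T) e : x y / x + y}.
Proof. by case: n / e. Qed.

Lemma tcat1r i (x : T i) : castdeg (V := T) (addn0 i) (tcat x (1 : T 0)) = x.
Proof.
elim: i x => [|[|i] IH] x; first by rewrite castdeg_id; apply: mulr1.
  by rewrite castdeg_id; apply: (ract1 (bimodP _)).
elim/tpow_ind: x => [|x x' ex ex'|w x].
- by rewrite tcat0l (additive0 (@castdegD _ _ _)).
- by rewrite tcatDl castdegD ex ex'.
- by rewrite tcat_pure (castdeg_ox _ (addn0 i.+1)) IH.
Qed.

Lemma tcatA i j l (x : T i) (y : T j) (z : T l) :
  castdeg (V := T) (addnA i j l) (tcat x (tcat y z)) = tcat (tcat x y) z.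
Proof.
elim: i x => [|[|i] IH] x; first by rewrite castdeg_id [RHS]tcat_lact.
  rewrite castdeg_id; case: j y {IH} => [|j] y; last by rewrite [RHS]tcat_pure.
  by rewrite [RHS]tcat_bal.
elim/tpow_ind: x => [|x x' ex ex'|w x].
- by rewrite !tcat0l (additive0 (@castdegD _ _ _)).
- by rewrite !tcatDl castdegD ex ex'.
- by rewrite !tcat_pure (castdeg_ox _ (addnA i.+1 j l)) IH.
Qed.

End Concatenation.


(** * Wedges of adjacent letters *)

Section WedgeAt.
Variables (k : fieldType) (A : algType k) (Om : dga A).
Notation V := (Om 1%N).
Notation T := (tpow Om).

Lemma wedge_at_lin n a : left_linear (@wedge_at k A Om n a).
Proof. exact: bimod_left_linear (wedge_at_bimod_map _ n a). Qed.

Lemma wedge_atD n a : {morph @wedge_at k A Om n a : x y / x + y}.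
Proof. exact: llinD (wedge_at_lin n a). Qed.

Lemma wedge_at0 n a : wedge_at a (0 : T n) = 0.
Proof. exact: (additive0 (@wedge_atD n a)). Qed.

Lemma wedge_at_pure n a (w : V) (x : T n.+1) :
  wedge_at a.+1 (w \ox x : T n.+2) = w \ox wedge_at a x.
Proof.
exact: (@idtmap_pure k A V (T n.+1) (wedge_cod Om n.+1 a) _ w x
  (wedge_at_lin n.+1 a)).
Qed.

Lemma wedge_at_tassoc n (u : T 2) (x : T n.+1) :
  wedge_at 0 (tassoc (u \ox x) : T n.+3) = wedge_map u \ox x.
Proof.
rewrite [LHS]/(tmap _ _ _) tassocVK.
by apply: tmap_pure; [apply: wedge_map_bimod_map | apply: bimod_map_id].
Qed.

(** Elementwise in y, since y is fixed while the word x is expanded. *)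
Lemma wedge_at_tcatr i j a (x : T i) (y : T j) : (a.+1 < j)%N ->
  wedge_at a y = 0 -> wedge_at (i + a) (tcat x y) = 0.
Proof.
case: j y => [|[|j]] // y _ y0.
elim: i x => [|[|i] IH] x.
- by rewrite [LHS](bmap_lact (wedge_at_bimod_map _ _ a)) y0 lact0r.
- by rewrite [LHS]wedge_at_pure y0 ox0.
elim/tpow_ind: x => [|x x' ex ex'|w x].
- by rewrite tcat0l wedge_at0.
- by rewrite tcatDl wedge_atD ex ex' addr0.
- by rewrite tcat_pure [LHS]wedge_at_pure IH ox0.
Qed.

(** Here the killed word is the one that would have to be expanded, so the
    wedge of x y is exhibited as a function of the wedge of x. *)
Lemma wedge_at_tcatl i j a (x : T i) (y : T j) : (a.+1 < i)%N ->
  wedge_at a x = 0 -> wedge_at a (tcat x y) = 0.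
Proof.
move=> lt_a x0.
suff [g gl ->] : exists2 g : wedge_cod Om i a -> wedge_cod Om (i + j) a,
    left_linear g & wedge_at a (tcat x y) = g (wedge_at a x).
  by rewrite x0 (additive0 (llinD gl)).
suff [g gl gE] : exists2 g : wedge_cod Om i a -> wedge_cod Om (i + j) a,
    left_linear g & forall x, wedge_at a (tcat x y) = g (wedge_at a x).
  by exists g.
elim: i a lt_a {x x0} => [|[|i] IH] // [|a] lt_a; last first.
  have [g gl gE] := IH a lt_a.
  exists (tmap (@id V) g); first exact: idtmap_left_linear.
  elim/tpow_ind=> [|x x' ex ex'|w x].
  - by rewrite tcat0l !wedge_at0 (additive0 (llinD (idtmap_left_linear V gl))).
  - rewrite tcatDl !wedge_atD ex ex'.
    by rewrite (llinD (idtmap_left_linear V gl)).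
  - rewrite tcat_pure wedge_at_pure [LHS]wedge_at_pure gE.
    by rewrite idtmap_pure.
case: i {IH lt_a} => [|i].
  case: j y => [|j] y.
    exists (fun c : Om 2%N => ract c y).
      split=> [c c'|a c]; first exact: (ractDl (bimodP _)).
      by rewrite (lractA (bimodP _)).
    by move=> u; rewrite tcat2_0 [LHS](bmap_ract (wedge_map_bimod_map _)).
  exists (fun c : Om 2%N => c \ox y).
    by split=> [c c'|a c]; [apply: oxDl | rewrite lact_pure].
  by move=> u; rewrite tcat2 [LHS]wedge_at_tassoc.
exists (tmap (@id (Om 2%N)) (fun x : T i.+1 => tcat x y)).
  by apply: idtmap_left_linear; apply: tcat_left_linear.
have gl := idtmap_left_linear (Om 2%N) (tcat_left_linear i.+1 y).
elim/tpow_ind2=> [|x x' ex ex'|u x].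
- by rewrite tcat0l !wedge_at0 (additive0 (llinD gl)).
- by rewrite tcatDl !wedge_atD ex ex' (llinD gl).
- rewrite tcat_tassoc [LHS]wedge_at_tassoc wedge_at_tassoc.
  rewrite idtmap_pure //; exact: tcat_left_linear.
Qed.

Lemma wedge_at0_tcat3 m (u : T 3) (t : T m.+1) :
  wedge_at 0 (tcat u t) = tassoc ((wedge_at 0 u : tens (Om 2%N) V) \ox t).
Proof.
elim/tpow_ind2: u => [|x x' ex ex'|u x].
- by rewrite tcat0l !wedge_at0 ox0l (bmap0 (tassoc_bimod_map _ _ _)).
- by rewrite tcatDl !wedge_atD ex ex' oxDl (bmapD (tassoc_bimod_map _ _ _)).
- by rewrite tcat_tassoc [LHS]wedge_at_tassoc wedge_at_tassoc tassoc_pure.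
Qed.

Lemma wedge_at1_tcat3 m (u : T 3) (t : T m.+1) :
  wedge_at 1 (tcat u t) = tassoc ((wedge_at 1 u : tens V (Om 2%N)) \ox t).
Proof.
elim/tpow_ind: u => [|x x' ex ex'|w x].
- by rewrite tcat0l !wedge_at0 ox0l (bmap0 (tassoc_bimod_map _ _ _)).
- by rewrite tcatDl !wedge_atD ex ex' oxDl (bmapD (tassoc_bimod_map _ _ _)).
- rewrite tcat_pure [LHS]wedge_at_pure wedge_at_pure tassoc_pure.
  by rewrite tcat2 [wedge_at 0 _]wedge_at_tassoc.
Qed.

(** The form in which wedge_a x = 0 implies wedge_b (F x) = 0 is stable under
    adding letters on the left. *)
Definition wedge_factors n (F : T n -> T n) (a b : nat) : Prop :=
  exists2 R : wedge_cod Om n a -> wedge_cod Om n b, left_linear R &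
    forall x, wedge_at b (F x) = R (wedge_at a x).

Lemma wedge_factors_ker n (F : T n -> T n) a b x :
  wedge_factors F a b -> wedge_at a x = 0 -> wedge_at b (F x) = 0.
Proof. by case=> R Rl -> ->; apply: additive0 (llinD Rl). Qed.

Lemma wedge_factors_shift n (F : T n.+1 -> T n.+1) (F' : T n.+2 -> T n.+2) a b :
    {morph F' : x y / x + y} ->
    (forall w x, F' (w \ox x : T n.+2) = w \ox F x) ->
  wedge_factors F a b -> wedge_factors F' a.+1 b.+1.
Proof.
move=> F'D F'E [R Rl RE]; have Rl' := idtmap_left_linear V Rl.
exists (tmap (@id V) R) => //; apply: tpow_ind => [|x x' ex ex'|w x].
- by rewrite (additive0 F'D) !wedge_at0 (additive0 (llinD Rl')).
- by rewrite F'D !wedge_atD ex ex' (llinD Rl').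
- by rewrite F'E !wedge_at_pure RE idtmap_pure.
Qed.

Lemma wedge_factors_tcat i j (F : T (i + j)%N -> T (i + j)%N) a b
    (R : wedge_cod Om (i + j) a -> wedge_cod Om (i + j) b) :
    {morph F : x y / x + y} -> left_linear R ->
    (forall (x : T i) (y : T j),
       wedge_at b (F (tcat x y)) = R (wedge_at a (tcat x y))) ->
  wedge_factors F a b.
Proof.
move=> FD Rl FR; exists R => //; apply: tcat_ind => [|x x' ex ex'|x y //].
  by rewrite (additive0 FD) !wedge_at0 (additive0 (llinD Rl)).
by rewrite FD !wedge_atD ex ex' (llinD Rl).
Qed.

End WedgeAt.

(** * Braid and wedge relations in all tensor powers *)

Section Braiding.
Variables (k : fieldType) (A : algType k) (Om : dga A).
Notation V := (Om 1%N).
Notation T := (tpow Om).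
Variable sigma : tens V V -> tens V V.
Hypothesis sigma_map : bimod_map sigma.
Notation s := (sigma_at sigma).
Notation sig n := (@sigma_at k A Om sigma n).

Lemma sigma_first_bimod_map p : bimod_map (@sigma_first k A Om sigma p).
Proof. by case: p => [|p] //; apply: tmap2_bimod_map. Qed.

Lemma sigma_at_bimod_map n a : bimod_map (@sigma_at k A Om sigma n a).
Proof.
elim: n a => [|[|n] IH] a; try exact: bimod_map_id.
case: a => [|a]; first exact: sigma_first_bimod_map.
exact: tmap_bimod_map (@bimod_map_id _ _ _) (IH a).
Qed.

Lemma sigma_atD n a : {morph @sigma_at k A Om sigma n a : x y / x + y}.
Proof. exact: bmapD (sigma_at_bimod_map n a). Qed.

Lemma sigma_at0 n a : s a (0 : T n) = 0.
Proof. exact: bmap0 (sigma_at_bimod_map n a). Qed.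

Lemma sigma_at_lin n a : left_linear (@sigma_at k A Om sigma n a).
Proof. exact: bimod_left_linear (sigma_at_bimod_map n a). Qed.

Lemma sigma_at_pure n a (w : V) (x : T n.+1) :
  sigma_at sigma a.+1 (w \ox x : T n.+2) = w \ox sigma_at sigma a x.
Proof. exact: (@idtmap_pure k A V (T n.+1) (T n.+1) _ w x (sigma_at_lin n.+1 a)). Qed.

Lemma sigma_at_tcatr i j a (x : T i) (y : T j) : (a.+1 < j)%N ->
  sigma_at sigma (i + a) (tcat x y) = tcat x (sigma_at sigma a y).
Proof.
case: j y => [|[|j]] // y _.
elim: i x => [|[|i] IH] x.
- exact: (bmap_lact (sigma_at_bimod_map _ a)).
- exact: sigma_at_pure.
elim/tpow_ind: x => [|x x' ex ex'|w x].
- by rewrite !tcat0l sigma_at0.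
- by rewrite !tcatDl sigma_atD ex ex'.
- by rewrite !tcat_pure [LHS]sigma_at_pure IH.
Qed.

Lemma sigma_at_tcatl i j a (x : T i) (y : T j) : (a.+1 < i)%N ->
  sigma_at sigma a (tcat x y) = tcat (sigma_at sigma a x) y.
Proof.
elim: i a x => [|[|i] IH] // [|a] x lt_a; last first.
  elim/tpow_ind: x => [|x x' ex ex'|w x].
  - by rewrite !(tcat0l, sigma_at0).
  - by rewrite !(tcatDl, sigma_atD) ex ex'.
  - by rewrite (@sigma_at_pure i a w x) !tcat_pure
               [LHS]sigma_at_pure IH.
case: i x {IH lt_a} => [|i] x.
  case: j y => [|j] y.
    by rewrite !tcat2_0 (bmap_ract (sigma_at_bimod_map _ _)).
  by rewrite !tcat2; apply: tmap2_tassoc.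
elim/tpow_ind2: x => [|x x' ex ex'|u x].
- by rewrite !(tcat0l, sigma_at0).
- by rewrite !(tcatDl, sigma_atD) ex ex'.
- rewrite tcat_tassoc [LHS]tmap2_tassoc // -tcat_tassoc; congr tcat.
  by symmetry; apply: tmap2_tassoc.
Qed.

Lemma sigma_at_far n a b (x : T n) : (a.+1 < b)%N -> (b < n.-1)%N ->
  s a (s b x) = s b (s a x).
Proof.
elim: n a b x => [|[|n] IH] // [|a] [|b] x // ab bn; last first.
  elim/tpow_ind: x => [|x x' ex ex'|w x].
  - by rewrite !sigma_at0.
  - by rewrite !sigma_atD ex ex'.
  - by rewrite !sigma_at_pure IH //; lia.
case: b ab bn => [|b] // _ bn; case: n {IH} x bn => [|[|n]] // x bn.
elim/(@tcat_ind k A Om 2 n.+2): x => [|x x' ex ex'|u x].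
- by rewrite !sigma_at0.
- by rewrite !sigma_atD ex ex'.
have sE (v : T 2) : s b.+2 (tcat v x) = tcat v (s b x).
  exact: (@sigma_at_tcatr 2 n.+2 b v x bn).
by rewrite sE !(@sigma_at_tcatl 2 n.+2 0) // sE.
Qed.

Hypothesis braid : braid_relation sigma.

Lemma sigma_at_braid n a (x : T n) : (a.+1 < n.-1)%N ->
  s a (s a.+1 (s a x)) = s a.+1 (s a (s a.+1 x)).
Proof.
elim: n a x => [|[|n] IH] // [|a] x lt_a; last first.
  elim/tpow_ind: x => [|x x' ex ex'|w x].
  - by rewrite !sigma_at0.
  - by rewrite !sigma_atD ex ex'.
  - by rewrite !sigma_at_pure IH //; lia.
case: n x {IH} lt_a => [|n] // x _.
elim/(@tcat_ind k A Om 3 n): x => [|x x' ex ex'|x y].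
- by rewrite !sigma_at0.
- by rewrite !sigma_atD ex ex'.
- rewrite !(@sigma_at_tcatl 3 n) //.
  exact: (congr1 (fun u : T 3 => tcat u y) (braid x)).
Qed.

Lemma wedge_sigma_far n a b (x : T n) : (a.+1 < b)%N || (b.+1 < a)%N ->
    (a < n.-1)%N -> (b < n.-1)%N ->
  wedge_at a x = 0 -> wedge_at a (s b x) = 0.
Proof.
move=> ab an bn; apply: wedge_factors_ker => {x}.
elim: n a b ab an bn => [|[|n] IH] // [|a] [|b] // ab an bn; last first.
- apply: (wedge_factors_shift (F := s b)); first exact: sigma_atD.
    exact: sigma_at_pure.
  by apply: IH; lia.
- case: a ab an {IH} => [|a] // _; case: n bn => [|[|n]] // _ an.
  apply: (@wedge_factors_tcat k A Om 2 n.+2 (s 0) a.+2 a.+2 (tmap2 sigma))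
    => [||u x].
  + exact: sigma_atD.
  + exact/bimod_left_linear/tmap2_bimod_map.
  have wE (v : T 2) : wedge_at a.+2 (tcat v x : T n.+4) = tassoc (v \ox wedge_at a x).
    rewrite tcat2; exact: (@idtmap2_tassoc _ _ V V (T n.+2)
      (wedge_cod Om n.+2 a) _ v x (wedge_at_lin _ _ _)).
  by rewrite (@sigma_at_tcatl 2 n.+2) // [LHS]wE wE [RHS]tmap2_tassoc.
- case: b ab bn {IH} => [|b] // _; case: n an => [|[|n]] // _ bn.
  have Rl := idtmap_left_linear (Om 2%N) (@sigma_at_lin n.+2 b).
  apply: (@wedge_factors_tcat k A Om 2 n.+2 (s b.+2) 0 0 (tmap id (sig n.+2 b)))
    => // [|u x].
    exact: sigma_atD.
  rewrite [s b.+2 _](@sigma_at_tcatr 2 n.+2 b u x bn) !tcat2.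
  rewrite [LHS]wedge_at_tassoc [wedge_at 0 _]wedge_at_tassoc idtmap_pure //.
  exact: sigma_at_lin.
Qed.

(** sigma2 braids a 2-form past a 1-form; [tmap2] carries its relation to sigma
    from three letters to words that go on to the right, and
    [wedge_factors_shift] adds letters on the left. *)
Lemma wedge_sigma_up n a (sigma2 : tens (Om 2%N) V -> tens V (Om 2%N)) :
    bimod_map sigma2 ->
    (forall x : T 3, wedge_at 1 (s 0 (s 1 x)) = sigma2 (wedge_at 0 x)) ->
    (a.+1 < n.-1)%N ->
  forall x : T n, wedge_at a x = 0 -> wedge_at a.+1 (s a (s a.+1 x)) = 0.
Proof.
move=> sigma2_map sigma2E lt_a.
have ssD m c : {morph (fun x : T m => s c (s c.+1 x)) : x y / x + y}.
  by move=> x y; rewrite !sigma_atD.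
move=> x; apply: (@wedge_factors_ker _ _ _ _ (fun x => s a (s a.+1 x))) => {x}.
elim: n a lt_a => [|[|n] IH] // [|a] lt_a; last first.
  apply: wedge_factors_shift (IH a _) => // w x.
  by rewrite !sigma_at_pure.
case: n lt_a {IH} => [|[|n]] // _.
  by exists sigma2; first exact: bimod_left_linear.
apply: (@wedge_factors_tcat k A Om 3 n.+1 _ 0 1 (tmap2 sigma2)) => // [|x y].
  exact/bimod_left_linear/tmap2_bimod_map.
rewrite !(@sigma_at_tcatl 3 n.+1) // [LHS]wedge_at1_tcat3.
by rewrite [wedge_at 0 _]wedge_at0_tcat3 [RHS]tmap2_tassoc // -sigma2E.
Qed.

Lemma wedge_sigma_down n a (sigma2 : tens V (Om 2%N) -> tens (Om 2%N) V) :
    bimod_map sigma2 ->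
    (forall x : T 3, wedge_at 0 (s 1 (s 0 x)) = sigma2 (wedge_at 1 x)) ->
    (a.+1 < n.-1)%N ->
  forall x : T n, wedge_at a.+1 x = 0 -> wedge_at a (s a.+1 (s a x)) = 0.
Proof.
move=> sigma2_map sigma2E lt_a.
have ssD m c : {morph (fun x : T m => s c.+1 (s c x)) : x y / x + y}.
  by move=> x y; rewrite !sigma_atD.
move=> x; apply: (@wedge_factors_ker _ _ _ _ (fun x => s a.+1 (s a x))) => {x}.
elim: n a lt_a => [|[|n] IH] // [|a] lt_a; last first.
  apply: wedge_factors_shift (IH a _) => // w x.
  by rewrite !sigma_at_pure.
case: n lt_a {IH} => [|[|n]] // _.
  by exists sigma2; first exact: bimod_left_linear.
apply: (@wedge_factors_tcat k A Om 3 n.+1 _ 1 0 (tmap2 sigma2)) => // [|x y].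
  exact/bimod_left_linear/tmap2_bimod_map.
rewrite !(@sigma_at_tcatl 3 n.+1) // [LHS]wedge_at0_tcat3.
by rewrite [wedge_at 1 _]wedge_at1_tcat3 [RHS]tmap2_tassoc // -sigma2E.
Qed.

Lemma wedge_sigma_anti n a (x : T n) :
    (forall u : tens V V, wedge_map (u + sigma u) = 0) ->
  (a < n.-1)%N -> wedge_at a (x + s a x) = 0.
Proof.
move=> anti; elim: n a x => [|[|n] IH] // [|a] x lt_a; last first.
  elim/tpow_ind: x => [|x x' ex ex'|w x].
  - by rewrite sigma_at0 addr0 wedge_at0.
  - by rewrite sigma_atD addrACA wedge_atD ex ex' addr0.
  - by rewrite sigma_at_pure -[X in wedge_at _ X]oxDr wedge_at_pure IH // ox0.
elim/(@tcat_ind k A Om 2 n): x => [|x x' ex ex'|x y].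
- by rewrite sigma_at0 addr0 wedge_at0.
- by rewrite sigma_atD addrACA wedge_atD ex ex' addr0.
- by rewrite (@sigma_at_tcatl 2 n) // -[_ + _](@tcatDl k A Om 2 n)
             (@wedge_at_tcatl k A Om 2 n) //; apply: anti.
Qed.

(** * Braided binomials as shuffles *)

Lemma shuf_sigmaD n i j p : {morph shuf (sig n) i j p : x y / x + y}.
Proof. exact/shuf_add/sigma_atD. Qed.

(** The offset p.+1 is tensoring by id on the left: this matches the recursion
    of the binomials with that of the shuffles. *)
Lemma idtmap_shuf n i j p (x : T n.+2) :
  tmap (@id V) (shuf (sig n.+1) i j p) x = shuf (sig n.+2) i j p.+1 x.
Proof.
have shufl : left_linear (shuf (sig n.+1) i j p).
  split=> [y z|a y]; first exact: shuf_sigmaD.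
  symmetry; apply: (@shuf_morph _ _ _ _ (lact a) 0%N) => [u v|b u _ _].
    exact: (lactDr (bimodP _)).
  by rewrite add0n (bmap_lact (sigma_at_bimod_map _ _)).
have tD := llinD (idtmap_left_linear V shufl).
elim/tpow_ind: x => [|x x' ex ex'|w x].
- by rewrite (additive0 tD) (additive0 (@shuf_sigmaD n.+2 i j p.+1)).
- by rewrite [LHS]tD ex ex' [RHS]shuf_sigmaD.
- rewrite [LHS]idtmap_pure //.
  apply: (@shuf_morph _ _ _ _ (fun y : T n.+1 => w \ox y : T n.+2) 1%N).
    by move=> y z; apply: oxDr.
  by move=> a y _ _; rewrite [RHS]sigma_at_pure.
Qed.

Lemma binom_shuf n j (x : T n) : (j <= n)%N ->
  binom sigma j x = shuf (sig n) (n - j) j 0 x.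
Proof.
elim: n j x => [|[|n] IH] j x le_jn.
- by case: j le_jn => // _; rewrite shufn0.
- by case: j le_jn => [|[|j]].
have [->|j_gt0] := posnP j; first by rewrite shufn0.
have [->|j_neq] := eqVneq j n.+2; first by rewrite subnn [LHS]/= ltnn.
case: j j_gt0 le_jn j_neq => [//|j] _ le_jn j_neq.
have lt_jn : (j.+1 < n.+2)%N by lia.
have -> : binom sigma j.+1 x =
    tmap (@id V) (@binom _ _ _ sigma n.+1 j) (chain (sig n.+2) 0 (n.+2 - j.+1) x)
    + tmap (@id V) (@binom _ _ _ sigma n.+1 j.+1) x.
  by rewrite [LHS]/= lt_jn.
have -> : @binom _ _ _ sigma n.+1 j = shuf (sig n.+1) (n - j).+1 j 0.
  by apply: boolp.funext => y; rewrite IH ?subSn //; lia.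
have -> : @binom _ _ _ sigma n.+1 j.+1 = shuf (sig n.+1) (n - j) j.+1 0.
  by apply: boolp.funext => y; rewrite IH ?subSS //; lia.
have -> : (n.+2 - j.+1 = (n - j).+1)%N by lia.
by rewrite shufSS addrC -!idtmap_shuf.
Qed.

Lemma binom_catE i j (x : T (i + j)%N) :
  binom sigma j x = shuf (sig (i + j)%N) i j 0 x.
Proof. by rewrite binom_shuf ?leq_addl // addnK. Qed.

Lemma binom_bimod_map i j :
  bimod_map (fun x : T (i + j)%N => binom sigma j x).
Proof.
apply: bimod_mapI => [x y|a x|x a]; rewrite !binom_catE.
- exact: shuf_sigmaD.
- symmetry; apply: (@shuf_morph _ _ _ _ (lact a) 0%N) => [u v|b u _ _].
    exact: (lactDr (bimodP _)).
  by rewrite (bmap_lact (sigma_at_bimod_map _ _)).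
- symmetry; apply: (@shuf_morph _ _ _ _ (fun u => ract u a) 0%N) => [u v|b u _ _].
    exact: (ractDl (bimodP _)).
  by rewrite (bmap_ract (sigma_at_bimod_map _ _)).
Qed.

(** [shufA] for the three words x, y, z, after both sides have been written as
    operators on their concatenation. *)
Lemma binomA i j l (x : T i) (y : T j) (z : T l) :
  castdeg (V := T) (addnA i j l)
    (binom sigma (j + l) (tcat x (binom sigma l (tcat y z)))) =
  binom sigma l (tcat (binom sigma j (tcat x y)) z).
Proof.
have castE m n (e : m = n) i' j' p (u : T m) : castdeg (V := T) e
    (shuf (sig m) i' j' p u) = shuf (sig n) i' j' p (castdeg (V := T) e u).
  by case: n / e.
rewrite !binom_catE.
have -> : tcat x (shuf (sig (j + l)%N) j l 0 (tcat y z)) =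
    shuf (sig (i + (j + l))%N) j l i (tcat x (tcat y z)).
  rewrite (@shuf_morph _ _ _ (sig (i + (j + l))) (tcat x) i) ?addn0 //.
    exact: tcatDr.
  by move=> a u _ lt_a; rewrite sigma_at_tcatr //; lia.
have -> : tcat (shuf (sig (i + j)%N) i j 0 (tcat x y)) z =
    shuf (sig (i + j + l)%N) i j 0 (tcat (tcat x y) z).
  apply: (@shuf_morph _ _ _ _ (fun u : T (i + j) => tcat u z) 0%N).
    by move=> u v; apply: tcatDl.
  by move=> a u _ lt_a; rewrite sigma_at_tcatl //; lia.
rewrite !castE tcatA; symmetry.
apply: (@shufA _ _ (i + j + l).-1) => [a|a b u|a u|]; last lia.
- exact: sigma_atD.
- exact: sigma_at_far.
- exact: sigma_at_braid.
Qed.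

End Braiding.

(** * Consequences of the connection axioms *)

Section FirstOrderForms.
Variables (k : fieldType) (A : algType k) (Om : dga A).
Notation V := (Om 1%N).

Lemma wedge_ract0 i (x : Om i.+1) (a : A) :
  castdeg (V := dga_deg Om) (addn0 i.+1) (wedge Om x (a : Om 0%N)) = ract x a.
Proof. exact: (wedge0r (dgaP Om)). Qed.

Lemma dd_ract (x : V) (a : A) :
  dd Om (ract x a) = ract (dd Om x) a - wedge_map (x \ox dd Om (a : Om 0%N)).
Proof.
have := d_Leibniz (dgaP Om) x (a : Om 0%N); rewrite castdeg_id expr1 scaleN1r.
have <- := wedge_ract0 x a; rewrite castdeg_id => ->.
have <- := wedge_ract0 (dd Om x) a; rewrite castdeg_id; congr (_ - _).
by rewrite /wedge_map tlift_pure //; apply: wedge_map_bal.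
Qed.

Lemma dd_mul (a b : A) : dd Om (a * b : Om 0%N) =
  ract (dd Om (a : Om 0%N)) b + lact a (dd Om (b : Om 0%N)).
Proof.
have := d_Leibniz (dgaP Om) (a : Om 0%N) (b : Om 0%N).
rewrite castdeg_id expr0 scale1r !(wedge0l (dgaP Om)) => ->.
by have <- := wedge_ract0 (dd Om (a : Om 0%N)) b; rewrite castdeg_id.
Qed.

(** 1-forms are sums of a db: these sums are stable under the right action,
    as (db) c = d(bc) - b dc, so the degree 1 part of the algebra generated
    by A and dA is contained in them. *)
Lemma Om1_ind (Q : V -> Prop) :
    Q 0 -> (forall x y, Q x -> Q y -> Q (x + y)) ->
    (forall a b : A, Q (lact a (dd Om (b : Om 0%N)))) -> forall x, Q x.
Proof.
pose span (x : V) := forall Q : V -> Prop, Q 0 ->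
  (forall x y, Q x -> Q y -> Q (x + y)) ->
  (forall a b : A, Q (lact a (dd Om (b : Om 0%N)))) -> Q x.
suff spanP x : span x by move=> Q0 QD Qd x; apply: spanP.
have span0 : span 0 by move=> R.
have spanD y z : span y -> span z -> span (y + z).
  by move=> sy sz R R0 RD Rd; apply: (RD); [apply: sy | apply: sz].
have span_d a b : span (lact a (dd Om (b : Om 0%N))) by move=> R _ _; apply.
have span_lact a y : span y -> span (lact a y).
  move/(_ (fun y => span (lact a y))); apply=> [|u v su sv|b c].
    by rewrite lact0r.
    by rewrite (lactDr (bimodP _)); apply: spanD.
  by rewrite -(lactM (bimodP _)); apply: span_d.
have span_ract a y : span y -> span (ract y a).
  move/(_ (fun y => span (ract y a))); apply=> [|u v su sv|b c].
    by rewrite ract0l.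
    by rewrite (ractDl (bimodP _)); apply: spanD.
  rewrite -(lractA (bimodP _)); apply: span_lact.
  have -> : ract (dd Om (c : Om 0%N)) a =
      dd Om (c * a : Om 0%N) + lact (- c) (dd Om (a : Om 0%N)).
    rewrite dd_mul -addrA -(lactDl (bimodP _)) subrr.
    by rewrite -(scale0r (1 : A)) (lactZ (bimodP _)) scale0r addr0.
  by apply: spanD => //; rewrite -[dd _ _](lact1 (bimodP _)).
pose P n : Om n -> Prop :=
  match n return Om n -> Prop with 1 => span | _ => fun=> True end.
apply: (generated (dgaP Om) (P := P) _ _ _ _ _ _ (n := 1%N)) => //.
- by move=> a; rewrite /P /= -[dd _ _](lact1 (bimodP _)).
- by case=> [|[|n]].
- by case=> [|[|n]] // y z; apply: spanD.
- by case=> [|[|n]] // c y sy; rewrite /P -(lactZ (bimodP _)); apply: span_lact.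
case=> [|[|i]] [|[|j]] //= y z Py Pz.
  rewrite [X in span X](@wedge0l _ _ _ _ _ _ _ (dgaP Om) 1%N y z).
  exact: span_lact.
by have := @wedge_ract0 0 y z; rewrite castdeg_id => ->; apply: span_ract.
Qed.

(** m (x) a db = m a (x) db, so additive maps are determined on exact right
    factors. *)
Lemma tens_Om1_ext (M : bimod A) (W : zmodType) (f g : tens M V -> W) :
    {morph f : x y / x + y} -> {morph g : x y / x + y} ->
    (forall m (a : A), f (m \ox dd Om (a : Om 0%N)) = g (m \ox dd Om (a : Om 0%N))) ->
  f =1 g.
Proof.
move=> fD gD fg; apply: tens_ext => // m.
apply: Om1_ind => [|x y ex ey|a b]; first by rewrite !ox0 !additive0.
  by rewrite !oxDr fD gD ex ey.
by rewrite -!ox_bal.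
Qed.

Variables (nabla : V -> tens V V) (sigma : tens V V -> tens V V).
Hypothesis conn : bimodule_connection nabla sigma.
Let sigma_map : bimod_map sigma := conn_sigma conn.

(** Apply the wedge to nabla (x a) = (nabla x) a + sigma (x (x) da) and compare
    with d (x a) = (dx) a - x da: this is the claim on x (x) da. *)
Lemma torsion_free_anti : torsion_free nabla ->
  forall u : tens V V, wedge_map (u + sigma u) = 0.
Proof.
move=> torsion; have wD := bmapD (wedge_map_bimod_map Om).
apply: (tens_Om1_ext (g := fun=> 0)) => [u v|u v|x a]; last 1 first.
- have := congr1 (@wedge_map k A Om) (conn_ract conn x (a : Om 0%N)).
  rewrite wD torsion dd_ract (bmap_ract (wedge_map_bimod_map Om)) torsion.
  by move/addrI=> e; rewrite wD -e subrr.
- by rewrite (bmapD sigma_map) addrACA [LHS]wD.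
- by rewrite addr0.
Qed.

(** Both expansions of nabla2 (x /\ y a), by the formula for nabla2 on products
    and by its right Leibniz rule, agree up to the terms in da, which gives the
    claim on x (x) y (x) da. *)
Lemma wedge_compatible_up : wedge_compatible nabla sigma ->
  exists2 sigma2 : tens (Om 2%N) V -> tens V (Om 2%N), bimod_map sigma2 &
    forall x : tpow Om 3,
      wedge_at 1 (sigma_at sigma 0 (sigma_at sigma 1 x)) = sigma2 (wedge_at 0 x).
Proof.
case=> nabla2 [sigma2 [conn2 nabla2E]].
exists sigma2; first exact: conn_sigma conn2.
have s2D := bmapD (conn_sigma conn2).
have wD n a := @wedge_atD k A Om n a.
have sD n a := @sigma_atD k A Om sigma sigma_map n a.
have e x y (a : A) : wedge_at 1 (sigma_at sigma 0
      (x \ox sigma (y \ox dd Om (a : Om 0%N)) : tpow Om 3)) =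
    sigma2 (wedge_map (x \ox y) \ox dd Om (a : Om 0%N)).
  have wE u v : wedge Om u v = wedge_map (u \ox v).
    by rewrite /wedge_map tlift_pure //; apply: wedge_map_bal.
  have := conn_ract conn2 (wedge Om x y) (a : Om 0%N).
  have -> : ract (wedge Om x y) a = wedge Om x (ract y a).
    by rewrite !wE -ract_pure (bmap_ract (wedge_map_bimod_map Om)).
  have tb := tmap_bimod_map (@bimod_map_id _ _ V) (wedge_map_bimod_map Om).
  rewrite !nabla2E (conn_ract conn) oxDr [sigma_at _ _ _]sD [wedge_at 1 (_ + _)]wD.
  rewrite -ract_pure (bmap_ract (tassoc_bimod_map _ _ _)) (bmap_ract tb).
  rewrite -[x \ox ract _ _]ract_pure (bmap_ract (sigma_at_bimod_map sigma_map 3 0)).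
  rewrite (bmap_ract (wedge_at_bimod_map Om 3 1)) addrA -(ractDl (bimodP _)).
  by move/addrI=> ->; rewrite wE.
apply: tpow_ind => [|x x' ex ex'|x u].
- by rewrite !(bmap0 (sigma_at_bimod_map sigma_map _ _)) !wedge_at0 (additive0 s2D).
- by rewrite !(sD, wD) ex ex' s2D.
have xD (M : bimod A) (f : tpow Om 3 -> M) : {morph f : u v / u + v} ->
    {morph (fun u : tens V V => f (x \ox u)) : u v / u + v}.
  by move=> fD u' v; rewrite oxDr fD.
apply: (tens_Om1_ext
  (f := fun u => wedge_at 1 (sigma_at sigma 0
                   (sigma_at sigma 1 (x \ox u : tpow Om 3))))
  (g := fun u => sigma2 (wedge_at 0 (x \ox u : tpow Om 3)))) => [||y a].
- apply: (xD _ (fun z => wedge_at 1 (sigma_at sigma 0 (sigma_at sigma 1 z)))).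
  by move=> u' v; rewrite !sD wD.
- by apply: (xD _ (fun z => sigma2 (wedge_at 0 z))) => u' v; rewrite wD s2D.
- rewrite [sigma_at sigma 1 _](@sigma_at_pure _ _ _ _ sigma_map 1) [LHS]e.
  by rewrite -tassoc_pure [wedge_at 0 _]wedge_at_tassoc.
Qed.

Lemma extendable_down : extendable sigma ->
  exists2 sigma2 : tens V (Om 2%N) -> tens (Om 2%N) V, bimod_map sigma2 &
    forall x : tpow Om 3,
      wedge_at 0 (sigma_at sigma 1 (sigma_at sigma 0 x)) = sigma2 (wedge_at 1 x).
Proof.
case=> sigma2 sigma2_map sigma2E; exists sigma2 => //.
have tD := bmapD sigma2_map.
apply: tpow_ind => [|x x' ex ex'|w x].
- rewrite !(bmap0 (sigma_at_bimod_map sigma_map _ _)) !wedge_at0.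
  by rewrite (additive0 tD).
- by rewrite !(sigma_atD sigma_map) !wedge_atD ex ex' tD.
elim/tens_ind: x => [|x x' ex ex'|y z].
- rewrite ox0 !(bmap0 (sigma_at_bimod_map sigma_map _ _)) !wedge_at0.
  by rewrite (additive0 tD).
- by rewrite oxDr !(sigma_atD sigma_map) !wedge_atD ex ex' tD.
rewrite [wedge_at 1 _]wedge_at_pure -sigma2E; congr (sigma2 (_ \ox _)).
by symmetry; apply: tlift_pure; apply: wedge_map_bal.
Qed.

End FirstOrderForms.

(** * The algebra of quantum symmetric forms *)

Section SymmetricProduct.
Variables (k : fieldType) (A : algType k) (Om : dga A).
Notation V := (Om 1%N).
Notation T := (tpow Om).
Variables (nabla : V -> tens V V) (sigma : tens V V -> tens V V).
Hypothesis conn : bimodule_connection nabla sigma.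
Hypothesis torsion : torsion_free nabla.
Hypothesis compatible : wedge_compatible nabla sigma.
Hypothesis ext : extendable sigma.
Hypothesis braid : braid_relation sigma.
Let sigma_map : bimod_map sigma := conn_sigma conn.

(** [ker_shuf] for K a u := (wedge_a u = 0): concatenating symmetric x and y
    leaves only the wedge at the junction unconstrained. *)
Lemma binom_symmetric i j (x : T i) (y : T j) :
  x \in Defs.symmetric_form (n := i) -> y \in Defs.symmetric_form (n := j) ->
  binom sigma j (tcat x y) \in Defs.symmetric_form (n := i + j).
Proof.
move=> /symmetric_formP xS /symmetric_formP yS; apply/symmetric_formP => a lt_a.
have [up up_map upE] := wedge_compatible_up conn compatible.
have [down down_map downE] := extendable_down conn ext.
rewrite (binom_catE sigma_map).
apply: (@ker_shuf _ _ (i + j).-1 _ _ (fun a (u : T (i + j)) => wedge_at a u = 0)).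
- exact: sigma_atD sigma_map _.
- by move=> b c u; apply: (sigma_at_far sigma_map).
- by move=> b; apply: wedge_at0.
- by move=> b u v u0 v0; rewrite wedge_atD u0 v0 addr0.
- by move=> b c u bc bN cN; apply: (wedge_sigma_far sigma_map).
- by move=> b u bN; apply: (wedge_sigma_up sigma_map up_map).
- by move=> b u bN; apply: (wedge_sigma_down sigma_map down_map).
- move=> b u bN; apply: (wedge_sigma_anti sigma_map) => //.
  exact: (torsion_free_anti conn).
- lia.
- move=> b _ lt_b b_neq; have [lt_bi|le_ib] := ltnP b.+1 i.
    by apply: wedge_at_tcatl => //; apply: xS; lia.
  rewrite -(subnKC (_ : i <= b)%N); last lia.
  by apply: wedge_at_tcatr; [lia | apply: yS; lia].
- by [].
- lia.
Qed.

Definition sym_mul i j (x : OmS Om i) (y : OmS Om j) : OmS Om (i + j)%N :=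
  exist _ (binom sigma j (tcat (OmS_val x) (OmS_val y)))
    (binom_symmetric (valP x) (valP y)).

Lemma OmS_val_inj n : injective (@OmS_val k A Om n).
Proof. exact: val_inj. Qed.

Lemma sym_mul_bal i j : balanced (@sym_mul i j).
Proof.
have bD := bmapD (binom_bimod_map sigma_map i j).
split=> [x x' y|x y y'|x a y]; apply: OmS_val_inj; rewrite /OmS_val /=.
- by rewrite tcatDl bD.
- by rewrite tcatDr bD.
- by rewrite tcat_bal.
Qed.

Definition odot i j : tens (OmS Om i) (OmS Om j) -> OmS Om (i + j)%N :=
  tlift (@sym_mul i j).

Lemma odot_pure i j (x : OmS Om i) (y : OmS Om j) : odot (x \ox y) = sym_mul x y.
Proof. exact/tlift_pure/sym_mul_bal. Qed.

Lemma odot_bimod_map i j : bimod_map (@odot i j).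
Proof.
have bm := binom_bimod_map sigma_map i j.
apply: tlift_bimod_map => [|a x y|x y a]; first exact: sym_mul_bal.
- by apply: OmS_val_inj; rewrite /OmS_val /= tcat_lact (bmap_lact bm).
- by apply: OmS_val_inj; rewrite /OmS_val /= tcat_ract (bmap_ract bm).
Qed.

Lemma OmS_val_cast m n (e : m = n) (x : OmS Om m) :
  OmS_val (castdeg (V := OmS Om) e x) = castdeg (V := T) e (OmS_val x).
Proof. by case: n / e. Qed.

Lemma odot_graded :
  graded_algebra (V := OmS Om) (OmS_one Om) (fun i j x y => odot (x \ox y)).
Proof.
split=> [i j x x' y|i j x y y'|i j c x y|i j c x y|j y|i x|i j l x y z].
- by rewrite oxDl (bmapD (@odot_bimod_map _ _)).
- by rewrite oxDr (bmapD (@odot_bimod_map _ _)).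
- rewrite -[c *: x](lactZ (bimodP _)) -lact_pure (bmap_lact (@odot_bimod_map _ _)).
  by rewrite (lactZ (bimodP _)).
- rewrite -[c *: y](ractZ (bimodP _)) -ract_pure (bmap_ract (@odot_bimod_map _ _)).
  by rewrite (ractZ (bimodP _)).
- rewrite odot_pure; apply: OmS_val_inj.
  rewrite [LHS](@binom_catE k A Om sigma sigma_map 0 j).
  exact: (lact1 (bimodP _)).
- apply: OmS_val_inj; rewrite OmS_val_cast odot_pure.
  rewrite [OmS_val _](@binom_catE k A Om sigma sigma_map i 0).
  by rewrite shufn0 tcat1r.
- by apply: OmS_val_inj; rewrite OmS_val_cast !odot_pure; apply: (binomA sigma_map).
Qed.

End SymmetricProduct.

Theorem corollary4p5 (k : fieldType) (A : algType k) (Om : dga A)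
    (nabla : Om 1%N -> tens (Om 1%N) (Om 1%N))
    (sigma : tens (Om 1%N) (Om 1%N) -> tens (Om 1%N) (Om 1%N)) :
  bimodule_connection nabla sigma ->
  torsion_free nabla ->
  wedge_compatible nabla sigma ->
  extendable sigma ->
  braid_relation sigma ->
  exists odot : forall i j : nat, tens (OmS Om i) (OmS Om j) -> OmS Om (i + j)%N,
    [/\ forall i j, bimod_map (odot i j),
        forall i j (x : OmS Om i) (y : OmS Om j),
          OmS_val (odot i j (x \ox y)) =
            binom sigma j (tcat (OmS_val x) (OmS_val y))
      & graded_algebra (V := OmS Om) (OmS_one Om) (fun i j x y => odot i j (x \ox y))].
Proof.
move=> conn torsion compatible ext braid.
exists (odot conn torsion compatible ext); split=> [i j|i j x y|].
- exact: odot_bimod_map.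
- by rewrite odot_pure.
- exact: odot_graded.
Qed.
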